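(* Let $d\in\mathbb{N}$, $\alpha>0$, and let $(\sigma,A)$ be an $\alpha$-Hölder continuous $\mathrm{GL}(d,\mathbb{R})$ cocycle over a transitive subshift of finite type $\sigma:\Sigma_H\to\Sigma_H$ with positive topological entropy. Suppose $(\sigma,A^{(n)})$, $n\in\mathbb{N}$, is a sequence of continuous $\mathrm{GL}(d,\mathbb{R})$ cocycles with $d_{\mathcal{C}^0}(A,A^{(n)})\to0$. If for some $\kappa>0$ $$h_{\mathrm{top}}(\sigma|_{\mathrm{B}(A^{(n)},\kappa)})\to h_{\mathrm{top}}(\sigma|_{\Sigma_H}),$$ then $(\sigma,A)$ is continuously conjugate to an isometric cocycle. In particular, if $h_{\mathrm{top}}(\sigma|_{\mathrm{B}(A,\kappa)})=h_{\mathrm{top}}(\sigma|_{\Sigma_H})$ for some $\kappa>0$, then $(\sigma,A)$ is continuously conjugate to an isometric cocycle.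
   Context: Alphabet $\mathcal{A}=\{1,\dots,N\}$, $H$ an $N\times N$ $\{0,1\}$-matrix; $\Sigma_H$ is the set of $(x_i)_{i\in\mathbb{Z}}\in\mathcal{A}^{\mathbb{Z}}$ with $H_{x_i,x_{i+1}}=1$ for all $i$, metric $\mathrm{dist}(x,y)=2^{-\min\{|i|:x_i\ne y_i\}}$, $\sigma$ the left shift; transitive means a dense forward orbit. A $\mathrm{GL}(d,\mathbb{R})$ cocycle is a continuous map $A:\Sigma_H\to\mathrm{GL}(d,\mathbb{R})$, with $A_0=\mathrm{Id}$, $A_n(x)=A(\sigma^{n-1}x)\cdots A(x)$, $A_{-n}(x)=(A_n(\sigma^{-n}x))^{-1}$ for $n\ge1$. $\|\cdot\|$ is the operator norm; $\alpha$-Hölder means $\|A(x)-A(y)\|\le C\,\mathrm{dist}(x,y)^\alpha$; $d_{\mathcal{C}^0}(A,B)=\sup_x\|A(x)-B(x)\|$. $\mathrm{B}(A,\kappa)=\{x\in\Sigma_H:\|A_n(x)^{\pm1}\|\le\kappa\text{ for all }n\in\mathbb{Z}\}$, a closed $\sigma$-invariant set; $h_{\mathrm{top}}$ is topological entropy. $(\sigma,A)$ is continuously conjugate to an isometric cocycle if there is a continuous $P:\Sigma_H\to\mathrm{GL}(d,\mathbb{R})$ with $P(\sigma(x))^{-1}A(x)P(x)\in\mathrm{O}(d)$ for all $x$. *)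

(* Defs.v *)
From HB Require Import structures.
From mathcomp Require Import all_boot all_order all_algebra.
From mathcomp Require Import all_classical all_reals all_analysis.
Set Implicit Arguments. Unset Strict Implicit. Unset Printing Implicit Defensive.
Import Order.TTheory GRing.Theory Num.Theory.
Import numFieldNormedType.Exports.
Local Open Scope classical_set_scope.
Local Open Scope ring_scope.

Section Defs.
Variable R : realType.
Variable N : nat.

Definition spoint := int -> 'I_N.

Definition SFT (H : 'M[bool]_N) : set spoint :=
  [set x | forall i : int, H (x i) (x (i + 1)%R)].

Definition shift (x : spoint) : spoint := fun i => x (i + 1)%R.
Definition shiftz (k : int) (x : spoint) : spoint := fun i => x (i + k)%R.

(* dist x y = 2^{-min{|i| : x_i <> y_i}} (and 0 if x = y) *)
Definition sdist (x y : spoint) : R :=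
  if pselect (exists i, x i != y i)
  then sup [set (2%:R ^- `|i|%N : R) | i in [set i | x i != y i]]
  else 0.

Definition enorm d (v : 'cV[R]_d) : R := Num.sqrt (\sum_i (v i 0) ^+ 2).
Definition opnorm d (M : 'M[R]_d) : R :=
  sup [set enorm (M *m v) | v in [set v : 'cV[R]_d | enorm v = 1]].

Fixpoint cocn d (A : spoint -> 'M[R]_d) (n : nat) (x : spoint) : 'M[R]_d :=
  match n with
  | 0 => 1%:M
  | n'.+1 => A (iter n' shift x) *m cocn A n' x
  end.
Definition cocz d (A : spoint -> 'M[R]_d) (n : int) (x : spoint) : 'M[R]_d :=
  match n with
  | Posz m => cocn A m x
  | Negz m => invmx (cocn A m.+1 (shiftz (Negz m) x))
  end.

Definition Bset H d (A : spoint -> 'M[R]_d) (kappa : R) : set spoint :=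
  [set x | SFT H x /\ forall n : int,
     opnorm (cocz A n x) <= kappa /\ opnorm (invmx (cocz A n x)) <= kappa].

Definition bowen_dist (n : nat) (x y : spoint) : R :=
  \big[Num.max/0]_(k < n) sdist (iter k shift x) (iter k shift y).
Definition separated (X : set spoint) (n : nat) (eps : R) (E : seq spoint) :=
  uniq E /\ (forall x, x \in E -> X x) /\
  (forall x y, x \in E -> y \in E -> x != y -> eps < bowen_dist n x y).
Definition sep_num (X : set spoint) (n : nat) (eps : R) : R :=
  sup [set (size E)%:R | E in separated X n eps].
Definition htop (X : set spoint) : \bar R :=
  ereal_sup [set limn_esup
                 (fun n : nat => ((n%:R)^-1 * ln (sep_num X n eps))%:E)
            | eps in [set e : R | 0 < e]].

Definition continuous_on_SFT H T (f : spoint -> 'M[R]_T) :=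
  forall x, SFT H x -> forall e : R, 0 < e -> exists2 del : R, 0 < del &
    forall y, SFT H y -> sdist x y < del -> opnorm (f y - f x) < e.
Definition GL_valued H d (f : spoint -> 'M[R]_d) :=
  forall x, SFT H x -> f x \in unitmx.
Definition holder H d (alpha : R) (A : spoint -> 'M[R]_d) :=
  exists C : R, forall x y, SFT H x -> SFT H y ->
    opnorm (A x - A y) <= C * powR (sdist x y) alpha.
Definition transitive_SFT H :=
  exists2 x, SFT H x & forall y, SFT H y -> forall e : R, 0 < e ->
    exists n : nat, sdist (iter n shift x) y < e.
Definition dC0 H d (A B : spoint -> 'M[R]_d) : \bar R :=
  ereal_sup [set (opnorm (A x - B x))%:E | x in SFT H].

Definition orthogonal_mx d (M : 'M[R]_d) := M^T *m M = 1%:M.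
Definition conj_isometric H d (A : spoint -> 'M[R]_d) :=
  exists P : spoint -> 'M[R]_d,
    [/\ continuous_on_SFT H P, GL_valued H P &
        forall x, SFT H x -> orthogonal_mx (invmx (P (shift x)) *m A x *m P x)].
End Defs.

(* Main.v *)
Require Import Defs.
From HB Require Import structures.
From mathcomp Require Import all_boot all_order all_algebra.
From mathcomp Require Import all_classical all_reals all_analysis.
From mathcomp Require Import zify ring lra.
Set Implicit Arguments. Unset Strict Implicit. Unset Printing Implicit Defensive.
Import Order.TTheory GRing.Theory Num.Theory.
Import numFieldNormedType.Exports.
Local Open Scope classical_set_scope.
Local Open Scope ring_scope.
Import Defs.

(* Forbidding a word of a transitive subshift of finite type strictly lowers its entropy, by   *)
(* an amount that depends only on the word. Hence the orbits of points of B(A^(n), kappa)      *)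
(* become dense, and in the limit A_n(y)^{+-1} is bounded uniformly in n and y. (The set       *)
(* B(A, kappa) itself need not be shift invariant; along the orbit of one of its points the    *)
(* products are bounded by a multiple of kappa^2, which suffices.)                             *)
(*                                                                                             *)
(* For a bounded Hoelder cocycle, let K(x) be the set of limits of A_n(y) as y -> x, n >= 0.   *)
(* Points following a common half-orbit have nearby products, and pigeonhole along a dense     *)
(* orbit yields long loops with product close to the identity; splicing such loops shows that  *)
(* K(x) varies continuously, while K(sigma x) A(x) = K(x). Minimizing the uniformly convex     *)
(* function sup_{g in K(x)} |g P g^T|^2 over the symmetric P with g P g^T >= 1 for all g in    *)
(* K(x) gives a unique, hence equivariant and continuous, positive definite form P(x). Its     *)
(* Cholesky factor is the conjugacy.                                                           *)

(** The proof has two halves. [uniformly_bounded] turns the entropy hypothesis into a bound on all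
    products of [A], using only continuity of [A]. [bounded_conj_isometric] conjugates a bounded
    cocycle, and there the Hoelder condition is used.

    The entropy gap [avoids_htop_lt] is a word count. A detour through the forbidden word can be
    inserted into an avoiding word at any of m places, and the place can be read off the result; so
    avoiding words are rarer by a factor m / C, with C independent of m. All words are
    supermultiplicative up to the same C, so m large compared with C gives a gap that persists under
    concatenation ([avoids_card_gap]).

    Conjugating to isometries amounts to finding a continuous field of positive definite forms Q
    with Q(sigma x) = A(x) Q(x) A(x)^T. A form determined canonically by K(x) has this property once
    K is equivariant ([tails_shift], [tails_unshift]) and continuous ([tails_close]);
    [minimizer_equivariant] and [minimizer_continuous] pass from K to the form. Existence,
    uniqueness and continuity of the minimizer all come from the uniform convexity in [adm_mid],
    through [near_min_close]. *)

Section EntrywiseNorm.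
Variable R : realType.
Implicit Types m n p d : nat.

(** The entrywise l1 norm stands in for the operator norm: it is submultiplicative, invariant under
    transposition and equivalent to [opnorm]. *)
Definition nm m n (M : 'M[R]_(m, n)) : R := \sum_i \sum_j `|M i j|.

Lemma nm_ge0 m n (M : 'M[R]_(m, n)) : 0 <= nm M.
Proof. by apply: sumr_ge0 => i _; apply: sumr_ge0 => j _. Qed.

Lemma nm0 m n : nm (0 : 'M[R]_(m, n)) = 0.
Proof. by rewrite /nm big1 // => i _; rewrite big1 // => j _; rewrite mxE normr0. Qed.

Lemma nm_entry m n (M : 'M[R]_(m, n)) i j : `|M i j| <= nm M.
Proof.
rewrite /nm (bigD1 i) //= (bigD1 j) //= -addrA lerDl.
by apply: addr_ge0; apply: sumr_ge0 => // k _; apply: sumr_ge0.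
Qed.

Lemma nm_le_entries m n (M : 'M[R]_(m, n)) e :
  (forall i j, `|M i j| <= e) -> nm M <= (m * n)%:R * e.
Proof.
move=> Me; apply: (@le_trans _ _ (\sum_(i < m) \sum_(j < n) e)).
  by apply: ler_sum => i _; apply: ler_sum => j _; apply: Me.
by rewrite !sumr_const !card_ord mulr_natl -mulrnA mulnC.
Qed.

Lemma nmD m n (M P : 'M[R]_(m, n)) : nm (M + P) <= nm M + nm P.
Proof.
rewrite /nm -big_split; apply: ler_sum => i _; rewrite -big_split.
by apply: ler_sum => j _; rewrite mxE ler_normD.
Qed.

Lemma nmN m n (M : 'M[R]_(m, n)) : nm (- M) = nm M.
Proof. by apply: eq_bigr => i _; apply: eq_bigr => j _; rewrite mxE normrN. Qed.

Lemma nmB m n (M P : 'M[R]_(m, n)) : nm (M - P) = nm (P - M).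
Proof. by rewrite -nmN opprB. Qed.

Lemma nm_tri m n (M P Q : 'M[R]_(m, n)) : nm (M - Q) <= nm (M - P) + nm (P - Q).
Proof. by rewrite -[M - Q](subrKA P) nmD. Qed.

Lemma nmZ m n a (M : 'M[R]_(m, n)) : nm (a *: M) = `|a| * nm M.
Proof.
rewrite /nm mulr_sumr; apply: eq_bigr => i _; rewrite mulr_sumr.
by apply: eq_bigr => j _; rewrite mxE normrM.
Qed.

Lemma nm_tr m n (M : 'M[R]_(m, n)) : nm M^T = nm M.
Proof.
rewrite /nm exchange_big; apply: eq_bigr => i _; apply: eq_bigr => j _.
by rewrite mxE.
Qed.

Lemma nmM m n p (M : 'M[R]_(m, n)) (P : 'M[R]_(n, p)) :
  nm (M *m P) <= nm M * nm P.
Proof.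
rewrite /nm mulr_suml; apply: ler_sum => i _.
apply: (@le_trans _ _ (\sum_j \sum_k `|M i k| * `|P k j|)).
  apply: ler_sum => j _; rewrite mxE; apply: le_trans (ler_norm_sum _ _ _) _.
  by apply: ler_sum => k _; rewrite normrM.
rewrite exchange_big mulr_suml; apply: ler_sum => k _.
rewrite -mulr_sumr ler_wpM2l // [leRHS](bigD1 k) //= lerDl.
by apply: sumr_ge0 => l _; apply: sumr_ge0.
Qed.

Lemma nmM_le m n p (M : 'M[R]_(m, n)) (P : 'M[R]_(n, p)) a b :
  nm M <= a -> nm P <= b -> nm (M *m P) <= a * b.
Proof.
by move=> Ma Pb; apply: le_trans (nmM _ _) _; apply: ler_pM => //; apply: nm_ge0.
Qed.

Lemma nm_leB m n (M P : 'M[R]_(m, n)) : nm M <= nm P + nm (M - P).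
Proof. by rewrite -{1}[M](subrK P) addrC nmD. Qed.

(** The squared Frobenius norm obeys the parallelogram identity, the source of uniform convexity
    later. *)
Definition fn2 m n (M : 'M[R]_(m, n)) : R := \sum_i \sum_j M i j ^+ 2.

Lemma fn2_ge0 m n (M : 'M[R]_(m, n)) : 0 <= fn2 M.
Proof. by apply: sumr_ge0 => i _; apply: sumr_ge0 => j _; rewrite sqr_ge0. Qed.

Lemma fn2_entry m n (M : 'M[R]_(m, n)) i j : M i j ^+ 2 <= fn2 M.
Proof.
rewrite /fn2 (bigD1 i) //= (bigD1 j) //= -addrA lerDl.
by apply: addr_ge0; apply: sumr_ge0 => k _;
  [rewrite sqr_ge0 | apply: sumr_ge0 => l _; rewrite sqr_ge0].
Qed.

Lemma fn2_eq0 m n (M : 'M[R]_(m, n)) : fn2 M <= 0 -> M = 0.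
Proof.
move=> M0; apply/matrixP => i j; rewrite mxE; apply/eqP.
by rewrite -sqrf_eq0 eq_le sqr_ge0 andbT (le_trans (fn2_entry M i j)).
Qed.

Lemma fn2Z m n a (M : 'M[R]_(m, n)) : fn2 (a *: M) = a ^+ 2 * fn2 M.
Proof.
rewrite /fn2 mulr_sumr; apply: eq_bigr => i _; rewrite mulr_sumr.
by apply: eq_bigr => j _; rewrite mxE exprMn.
Qed.

Lemma fn2_parallelogram m n (M P : 'M[R]_(m, n)) :
  fn2 (2^-1 *: (M + P)) = 2^-1 * (fn2 M + fn2 P) - 4^-1 * fn2 (M - P).
Proof.
rewrite /fn2 -big_split !mulr_sumr -sumrB; apply: eq_bigr => i _.
rewrite -big_split !mulr_sumr -sumrB; apply: eq_bigr => j _ /=.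
by rewrite !mxE; field.
Qed.

Lemma fn2_nm m n (M : 'M[R]_(m, n)) : fn2 M <= nm M ^+ 2.
Proof.
rewrite expr2 {1}/nm mulr_suml; apply: ler_sum => i _.
rewrite mulr_suml; apply: ler_sum => j _.
by rewrite -[M i j ^+ 2]ger0_norm ?sqr_ge0 // normrX expr2 ler_wpM2l // nm_entry.
Qed.

Lemma nm_fn2 m n (M : 'M[R]_(m, n)) : nm M ^+ 2 <= (m * n)%:R ^+ 2 * fn2 M.
Proof.
have -> : (m * n)%:R ^+ 2 * fn2 M = ((m * n)%:R * Num.sqrt (fn2 M)) ^+ 2.
  by rewrite exprMn sqr_sqrtr ?fn2_ge0.
rewrite ler_sqr ?nnegrE ?nm_ge0 ?mulr_ge0 ?sqrtr_ge0 //.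
apply: nm_le_entries => i j.
by rewrite -sqrtr_sqr ler_wsqrtr // fn2_entry.
Qed.

Lemma fn2_le_add m n (M P : 'M[R]_(m, n)) :
  fn2 M <= fn2 P + nm (M - P) * (nm M + nm P).
Proof.
rewrite -lerBlDl /fn2 -sumrB mulr_suml; apply: ler_sum => i _.
rewrite -sumrB mulr_suml; apply: ler_sum => j _.
rewrite subr_sqr; apply: le_trans (ler_norm _) _.
rewrite normrM !mxE ler_wpM2l //.
by apply: le_trans (ler_normD _ _) _; apply: lerD; apply: nm_entry.
Qed.

Definition sqn d (v : 'cV[R]_d) : R := \sum_i v i 0 ^+ 2.
Definition qform d (M : 'M[R]_d) (v : 'cV[R]_d) : R := (v^T *m M *m v) 0 0.

Lemma qformD d (M P : 'M[R]_d) v : qform (M + P) v = qform M v + qform P v.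
Proof. by rewrite /qform mulmxDr mulmxDl mxE. Qed.

Lemma qformZ d a (M : 'M[R]_d) v : qform (a *: M) v = a * qform M v.
Proof. by rewrite /qform -scalemxAr -scalemxAl mxE. Qed.

Lemma qform1 d (v : 'cV[R]_d) : qform 1%:M v = sqn v.
Proof.
by rewrite /qform mulmx1 mxE; apply: eq_bigr => i _; rewrite mxE expr2.
Qed.

Lemma sqn_ge0 d (v : 'cV[R]_d) : 0 <= sqn v.
Proof. by apply: sumr_ge0 => i _; rewrite sqr_ge0. Qed.

Lemma sqn_gt0 d (v : 'cV[R]_d) : v != 0 -> 0 < sqn v.
Proof.
move=> v0; rewrite lt_def sqn_ge0 andbT; apply: contra v0 => /eqP v0.
apply/eqP/matrixP => i j; rewrite (ord1 j) mxE; apply/eqP; rewrite -sqrf_eq0.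
rewrite eq_le sqr_ge0 andbT -v0 /sqn (bigD1 i) //= lerDl.
by apply: sumr_ge0 => k _; rewrite sqr_ge0.
Qed.

Lemma sqn_entry d (v : 'cV[R]_d) i : `|v i 0| ^+ 2 <= sqn v.
Proof.
rewrite -normrX ger0_norm ?sqr_ge0 // /sqn (bigD1 i) //= lerDl.
by apply: sumr_ge0 => k _; rewrite sqr_ge0.
Qed.

Lemma qform_nm d (M : 'M[R]_d) v : `|qform M v| <= nm M * sqn v.
Proof.
rewrite /qform mxE; apply: le_trans (ler_norm_sum _ _ _) _.
rewrite /nm exchange_big mulr_suml; apply: ler_sum => j _ /=.
rewrite mxE mulr_suml; apply: le_trans (ler_norm_sum _ _ _) _.
rewrite mulr_suml; apply: ler_sum => i _.
rewrite !mxE !normrM mulrAC mulrC ler_wpM2l //.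
have := sqn_entry v i; have := sqn_entry v j.
have : 0 <= (`|v i 0| - `|v j 0|) ^+ 2 by rewrite sqr_ge0.
by nra.
Qed.

Lemma qform_conj d (g M : 'M[R]_d) v : qform (g *m M *m g^T) v = qform M (g^T *m v).
Proof. by rewrite /qform trmx_mul trmxK !mulmxA. Qed.

Lemma sqn_mul d (g : 'M[R]_d) v : sqn (g *m v) <= nm g ^+ 2 * sqn v.
Proof.
have <- : qform (g^T *m g) v = sqn (g *m v).
  by rewrite -qform1 /qform mulmx1 trmx_mul !mulmxA.
apply: le_trans (ler_norm _) _; apply: le_trans (qform_nm _ _) _.
by rewrite ler_wpM2r ?sqn_ge0 // expr2 -{1}(nm_tr g) nmM.
Qed.

Lemma enorm_sq d (v : 'cV[R]_d) : enorm v ^+ 2 = sqn v.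
Proof. by rewrite sqr_sqrtr // sqn_ge0. Qed.

Lemma opnorm_set_ubound d (M : 'M[R]_d) :
  ubound [set enorm (M *m v) | v in [set v : 'cV[R]_d | enorm v = 1]] (nm M).
Proof.
move=> _ [v /= v1 <-].
rewrite -(@ler_pXn2r _ 2%N) ?nnegrE ?nm_ge0 ?sqrtr_ge0 // enorm_sq.
by apply: le_trans (sqn_mul _ _) _; rewrite -(enorm_sq v) v1 expr1n mulr1.
Qed.

Lemma enorm_delta d (j : 'I_d) : enorm (delta_mx j 0 : 'cV[R]_d) = 1.
Proof.
rewrite /enorm (bigD1 j) //= big1 ?addr0; last first.
  by move=> i /negbTE ij; rewrite mxE ij /= expr0n.
by rewrite mxE !eqxx expr1n sqrtr1.
Qed.

Lemma opnorm_le_nm d (M : 'M[R]_d) : opnorm M <= nm M.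
Proof.
(* For d = 0 there is no unit vector, and the supremum of the empty set is 0. *)
rewrite /opnorm; have [->|/set0P ne] := eqVneq
  [set enorm (M *m v) | v in [set v : 'cV[R]_d | enorm v = 1]] set0.
  by rewrite sup0 nm_ge0.
by apply: ge_sup => //; apply: opnorm_set_ubound.
Qed.

Lemma nm_le_opnorm d (M : 'M[R]_d) : nm M <= (d * d)%:R * opnorm M.
Proof.
apply: nm_le_entries => i j.
apply: (@le_trans _ _ (enorm (M *m delta_mx j 0))).
  rewrite -(@ler_pXn2r _ 2%N) ?nnegrE ?sqrtr_ge0 // enorm_sq -colE.
  by apply: le_trans (sqn_entry _ i); rewrite mxE.
apply: ub_le_sup; first by exists (nm M); apply: opnorm_set_ubound.
by exists (delta_mx j 0) => //=; rewrite enorm_delta.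
Qed.

Lemma opnorm_ge0 d (M : 'M[R]_d) : 0 <= opnorm M.
Proof.
rewrite /opnorm; have [->|/set0P[x xS]] := eqVneq
  [set enorm (M *m v) | v in [set v : 'cV[R]_d | enorm v = 1]] set0.
  by rewrite sup0.
apply: (@le_trans _ _ x); first by case: xS => v _ <-; apply: sqrtr_ge0.
by apply: ub_le_sup xS; exists (nm M); apply: opnorm_set_ubound.
Qed.

Lemma opnorm0 d : opnorm (0 : 'M[R]_d) = 0.
Proof.
by apply/eqP; rewrite eq_le opnorm_ge0 andbT -[leRHS](nm0 d d) opnorm_le_nm.
Qed.

End EntrywiseNorm.

(** * Cylinders, gluing and recurrence in the subshift *)

Section SymbolicPoints.
Variables (R : realType) (N : nat) (H : 'M[bool]_N).
Implicit Types (x y z : spoint N) (r n : nat).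

Lemma iter_shift n x : iter n (@shift N) x = shiftz n%:Z x.
Proof.
elim: n => [|n IHn] /=; first by apply/funext => i; rewrite /shiftz addr0.
by rewrite IHn; apply/funext => i; rewrite /shift /shiftz; congr (x _); lia.
Qed.

Lemma shiftzD (a b : int) x : shiftz a (shiftz b x) = shiftz (a + b) x.
Proof. by apply/funext => i; rewrite /shiftz addrA. Qed.

Lemma shiftz0 x : shiftz 0 x = x.
Proof. by apply/funext => i; rewrite /shiftz addr0. Qed.

Lemma SFT_shiftz (a : int) x : SFT H x -> SFT H (shiftz a x).
Proof. by move=> Hx i; rewrite /shiftz addrAC; apply: Hx. Qed.

(** These cylinders replace the metric; [sdist_agree] and [agree_sdist] translate between the
    two. *)
Definition agree r x y := forall i : int, (`|i| <= r)%N -> x i = y i.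

Lemma agree_sym r x y : agree r x y -> agree r y x.
Proof. by move=> xy i ir; rewrite xy. Qed.

Lemma agree_trans r x y z : agree r x y -> agree r y z -> agree r x z.
Proof. by move=> xy yz i ir; rewrite xy ?yz. Qed.

Lemma agree_le r r' x y : (r <= r')%N -> agree r' x y -> agree r x y.
Proof. by move=> rr xy i ir; apply: xy; apply: leq_trans rr. Qed.

Lemma agree_shiftz r r' (a : int) x y :
  (r + `|a| <= r')%N -> agree r' x y -> agree r (shiftz a x) (shiftz a y).
Proof. by move=> rr xy i ir; rewrite /shiftz; apply: xy; lia. Qed.

Lemma sdist_set_ubound x y :
  ubound [set (2%:R ^- `|i|%N : R) | i in [set i | x i != y i]] 1.
Proof.
move=> _ [i _ <-]; rewrite invf_le1 ?exprn_gt0 //.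
by rewrite exprn_ege1 // ler1n.
Qed.

Lemma sdist_agree r x y : agree r x y -> sdist R x y <= 2%:R ^- r.
Proof.
move=> xy; rewrite /sdist; case: pselect => [[i xyi]|ne] /=; last first.
  by rewrite invr_ge0 exprn_ge0.
apply: ge_sup; first by exists (2%:R ^- `|i|%N); exists i.
move=> _ [j /= xyj <-].
rewrite lef_pV2 ?posrE ?exprn_gt0 // ler_eXn2l ?ltr1n //.
by rewrite leqNgt; apply: contraNN xyj => jr; rewrite xy // ltnW.
Qed.

Lemma agree_sdist r x y : sdist R x y < 2%:R ^- r -> agree r x y.
Proof.
move=> + i ir; rewrite /sdist; case: pselect => [ne|ne] /=; last first.
  move=> _.
  by apply/eqP; apply: contra_notT ne => xyi; exists i.
move=> dxy; apply/eqP; apply: contraTT dxy => xyi; rewrite -leNgt.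
apply: (@le_trans _ _ (2%:R ^- `|i|%N)).
  by rewrite lef_pV2 ?posrE ?exprn_gt0 // ler_eXn2l ?ltr1n.
apply: ub_le_sup; first by exists 1; apply: sdist_set_ubound.
by exists i.
Qed.

Lemma exp2V_small (e : R) : 0 < e -> exists r, 2%:R ^- r < e.
Proof.
move=> e0; have [r er] : exists r : nat, e^-1 < r%:R.
  by exists (Num.bound e^-1); rewrite archi_boundP // invr_ge0 ltW.
exists r; rewrite invf_plt ?posrE ?exprn_gt0 //; apply: lt_trans er _.
by rewrite -natrX ltr_nat ltn_expl.
Qed.

Definition glue x y : spoint N := fun i => if (i < 0)%R then x i else y i.

Lemma SFT_glue x y : SFT H x -> SFT H y -> x 0 = y 0 -> SFT H (glue x y).
Proof.
move=> Hx Hy xy i; rewrite /glue; case: (ltP i 0) => i0.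
  case: ltP => i1; first exact: Hx.
  have i1E : i + 1 = 0 by lia.
  by rewrite i1E -xy -i1E; apply: Hx.
by rewrite ifF; [exact: Hy | lia].
Qed.

Lemma glueL x y (i : int) : x 0 = y 0 -> (i <= 0)%R -> glue x y i = x i.
Proof. by rewrite /glue => xy; case: ltP => // i0 i1; have -> : i = 0 by lia. Qed.

Lemma glueR x y (i : int) : (0 <= i)%R -> glue x y i = y i.
Proof. by rewrite /glue leNgt; case: (i < 0). Qed.

(** When both points agree with a third on [-r, r], the cut at 0 is invisible there: the glued point
    follows [x] up to time r and, by [glue_future], [y] from time -r on. This overlap makes the
    Hoelder errors of gluing small. *)
Lemma glue_past r x y z (i : int) : agree r x z -> agree r y z ->
  i <= r%:Z -> glue x y i = x i.
Proof.
move=> xz yz ir; case: (lerP i 0) => i0; first by rewrite glueL // xz // yz.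
by rewrite glueR ?xz ?yz //; lia.
Qed.

Lemma glue_future r x y z (i : int) : agree r x z -> agree r y z ->
  - r%:Z <= i -> glue x y i = y i.
Proof.
move=> xz yz ir; case: (lerP 0 i) => i0; first by rewrite glueR.
by rewrite glueL ?xz ?yz //; lia.
Qed.

Definition recurrent x := forall y r m, SFT H y ->
  exists2 n, (m <= n)%N & agree r (shiftz n%:Z x) y.

Lemma transitive_recurrent : transitive_SFT R H ->
  exists2 x, SFT H x & recurrent x.
Proof.
move=> [x Hx dx]; exists x => // y r m Hy.
have e0 : (0 : R) < 2%:R ^- (r + m) by rewrite invr_gt0 exprn_gt0.
(* Approximating the m-th preimage of [y] yields a visit to [y] at time n + m, hence not before
   m. *)
have [n dn] := dx (shiftz (- m%:Z) y) (SFT_shiftz _ Hy) _ e0.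
exists (n + m)%N; first exact: leq_addl.
have := agree_sdist dn; rewrite iter_shift.
move/(@agree_shiftz r (r + m) m%:Z); rewrite !shiftzD subrr shiftz0 addrC -PoszD.
by apply; lia.
Qed.

End SymbolicPoints.

(** * Counting words, with and without a forbidden block *)

(** The codes below depend on chosen witness points, so they are given as relations rather than
    functions. *)
Lemma card_le_rel (S T : finType) (A : {set S}) (B : {set T}) (f : S -> T -> Prop) :
  (forall a, a \in A -> exists2 b, b \in B & f a b) ->
  (forall a a' b, a \in A -> a' \in A -> f a b -> f a' b -> a = a') ->
  (#|A| <= #|B|)%N.
Proof.
move=> AB inj; have [->|[a0 a0A]] := set_0Vmem A; first by rewrite cards0.
have [b0 _ _] := AB _ a0A.
have [h hP] : {h : S -> T & forall a, a \in A -> h a \in B /\ f a (h a)}.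
  apply: (@choice _ _ (fun a b => a \in A -> b \in B /\ f a b)) => a.
  have [aA|_] := boolP (a \in A); last by exists b0.
  by have [b bB fab] := AB a aA; exists b.
rewrite -(@card_in_imset _ _ h) => [|a a' aA a'A haa'].
  by apply: subset_leq_card; apply/fintype.subsetP => _ /imsetP[a aA ->]; apply: (hP a aA).1.
by apply: (inj a a' (h a)) => //; [apply: (hP a aA).2 | rewrite haa'; apply: (hP a' a'A).2].
Qed.

Section Words.
Variables (N : nat) (H : 'M[bool]_N).
Implicit Types (x y z : spoint N) (X : set (spoint N)).

Definition word n x : {ffun 'I_n -> 'I_N} := [ffun i : 'I_n => x (Posz i)].

Definition lang X n : {set {ffun 'I_n -> 'I_N}} :=
  [set u | `[< exists2 x, X x & word n x = u >]]%SET.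

Lemma langP X n u : reflect (exists2 x, X x & word n x = u) (u \in lang X n).
Proof. by rewrite inE; apply: asboolP. Qed.

Lemma mem_lang X n x : X x -> word n x \in lang X n.
Proof. by move=> Xx; apply/langP; exists x. Qed.

Lemma eq_word n x y :
  (forall i : nat, (i < n)%N -> x i%:Z = y i%:Z) -> word n x = word n y.
Proof. by move=> xy; apply/ffunP => i; rewrite !ffunE xy. Qed.

Lemma word_eq n x y i : word n x = word n y -> (i < n)%N -> x i%:Z = y i%:Z.
Proof. by move=> /ffunP xy lin; have := xy (Ordinal lin); rewrite !ffunE. Qed.

Lemma card_langD X a b : (forall x n, X x -> X (shiftz n%:Z x)) ->
  (#|lang X (a + b)| <= #|lang X a| * #|lang X b|)%N.
Proof.
move=> XS; rewrite -cardsX.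
apply: (@card_le_rel _ _ _ _ (fun u p => exists2 x, X x &
  word (a + b) x = u /\ p = (word a x, word b (shiftz a%:Z x)))).
  move=> _ /langP[x Xx <-]; exists (word a x, word b (shiftz a%:Z x)); last by exists x.
  by rewrite inE /= !mem_lang //; apply: XS.
move=> _ _ _ _ _ [x Xx [<- ->]] [y Xy [<- [xy1 xy2]]].
apply: eq_word => i iab; case: (ltnP i a) => ia; first exact: (word_eq xy1).
have iE : i%:Z = (i - a)%N%:Z + a%:Z by lia.
by rewrite iE; apply: (word_eq xy2); lia.
Qed.

Lemma card_langX X a k : (forall x n, X x -> X (shiftz n%:Z x)) ->
  (#|lang X (k * a)| <= #|lang X a| ^ k)%N.
Proof.
move=> XS; elim: k => [|k IHk].
  by rewrite mul0n expn0; apply: leq_trans (max_card _) _; rewrite card_ffun !card_ord expn0.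
by rewrite mulSn expnS; apply: leq_trans (card_langD _ _ XS) _; rewrite leq_mul2l IHk orbT.
Qed.

Lemma card_lang_mono X a b : (a <= b)%N -> (#|lang X a| <= #|lang X b|)%N.
Proof.
move=> ab; apply: (@card_le_rel _ _ _ _ (fun u v => exists2 x, X x &
  word a x = u /\ v = word b x)).
  by move=> _ /langP[x Xx <-]; exists (word b x); [apply: mem_lang | exists x].
move=> _ _ _ _ _ [x Xx [<- ->]] [y Xy [<- xy]].
by apply: eq_word => i ia; apply: (word_eq xy); apply: leq_trans ab.
Qed.

(* [y] on [0, L) is the word whose occurrences are tracked. *)
Definition occurs y L x (i : int) := forall j : nat, (j < L)%N -> x (i + j%:Z) = y j%:Z.

(** Only nonnegative positions count: the set is forward invariant, as [card_langX] requires, and a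
    point of the subshift outside it meets the word in forward time. *)
Definition avoids y L : set (spoint N) :=
  [set x | SFT H x /\ forall i : nat, ~ occurs y L x i%:Z].

Lemma avoids_shift y L x n : avoids y L x -> avoids y L (shiftz n%:Z x).
Proof.
move=> [Hx nx]; split => [|i ox]; first exact: SFT_shiftz.
apply: (nx (i + n)%N) => j jL; rewrite -(ox j jL) /shiftz; congr (x _); lia.
Qed.

(** A join depends only on the two symbols at its ends, and there are finitely many pairs, whence a
    common [T]. The joining block is cut from the recurrent orbit between a visit to the first
    symbol, a later visit to the word and a still later visit to the second symbol. *)
Lemma connect_through x0 y L : SFT H x0 -> recurrent H x0 -> SFT H y ->
  exists T : nat, forall x x', SFT H x -> SFT H x' ->
    exists t : nat, exists2 z, SFT H z &
      [/\ (t <= T)%N, (forall i : int, i <= 0 -> z i = x i),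
          (forall i : int, 0 <= i -> z (i + t%:Z) = x' i) &
          exists2 q : nat, (q + L <= t)%N & occurs y L z q%:Z].
Proof.
move=> Hx0 rec Hy.
pose conn (a b : 'I_N) t := exists2 z, SFT H z & [/\ z 0 = a, z t%:Z = b &
  exists2 q : nat, (q + L <= t)%N & occurs y L z q%:Z].
have connE x x' : SFT H x -> SFT H x' -> exists t, conn (x 0) (x' 0) t.
  move=> Hx Hx'; have [s _ sx] := rec x 0%N 0%N Hx.
  have [n sn ny] := rec y L s Hy; have [s' ns' sx'] := rec x' 0%N (n + L)%N Hx'.
  exists (s' - s)%N; exists (shiftz s%:Z x0); first exact: SFT_shiftz.
  split; first by rewrite -sx.
    by rewrite -sx' // /shiftz; congr (x0 _); lia.
  exists (n - s)%N; first by lia.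
  move=> j jL; rewrite -(ny j%:Z); last by lia.
  by rewrite /shiftz; congr (x0 _); lia.
have [f fP] : {f : 'I_N * 'I_N -> nat & forall p, forall x x', SFT H x -> SFT H x' ->
    p = (x 0, x' 0) -> conn p.1 p.2 (f p)}.
  apply: (@choice _ _ (fun p t => forall x x', SFT H x -> SFT H x' ->
    p = (x 0, x' 0) -> conn p.1 p.2 t)) => -[a b] /=.
  have [[x [x' [Hx Hx' ab]]]|nab] := pselect (exists x x', [/\ SFT H x, SFT H x' &
      (a, b) = (x 0, x' 0)]).
    have [t tP] := connE _ _ Hx Hx'; exists t => z z' _ _ _.
    by case: ab => -> ->.
  by exists 0%N => x x' Hx Hx' ab; case: nab; exists x, x'.
exists (\max_p f p)%N => x x' Hx Hx'; pose p := (x 0, x' 0).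
have [z Hz [z0 zt [q qt qo]]] := fP p x x' Hx Hx' erefl.
exists (f p); pose z1 := glue x z; set t := f p in zt qt *.
have Hz1 : SFT H z1 by apply: SFT_glue => //; rewrite z0.
have z1t : shiftz t%:Z z1 0 = x' 0 by rewrite /shiftz /z1 glueR ?add0r ?zt //; lia.
pose z2 := shiftz (- t%:Z) (glue (shiftz t%:Z z1) x').
have z2L (i : int) : i <= t%:Z -> z2 i = z1 i.
  move=> it; rewrite /z2 /shiftz glueL //; last by lia.
  by congr (z1 _); lia.
exists z2.
  by apply: SFT_shiftz; apply: SFT_glue => //; apply: SFT_shiftz.
split; first exact: leq_bigmax.
- by move=> i i0; rewrite z2L; [rewrite /z1 glueL // z0|lia].
- by move=> i i0; rewrite /z2 /shiftz glueR; [congr (x' _); lia|lia].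
exists q => // j jL; rewrite z2L; last by lia.
by rewrite /z1 glueR ?qo //; lia.
Qed.

Section Counting.
Variables (x0 y : spoint N) (L : nat).
Hypotheses (Hx0 : SFT H x0) (rec : recurrent H x0) (Hy : SFT H y).

(** Both bounds are injections into [S n], whose elements pair a detour length with a word of length
    n + T. For the second, the detour is inserted at position i * T with i < m. An avoiding word has
    no occurrence before that position, so the first occurrence reveals i. *)
Lemma counting_bounds : exists C : nat, [/\ (0 < C)%N,
  (forall a b, (#|lang (SFT H) a| * #|lang (SFT H) b| <= C * #|lang (SFT H) (a + b)|)%N) &
  (forall m, exists n, forall n', (n <= n')%N ->
     (m * #|lang (avoids y L) n'| <= C * #|lang (SFT H) n'|)%N)].
Proof.
have [T conn] := connect_through L Hx0 rec Hy.
have WD a b := @card_langD (SFT H) a b (fun x n => @SFT_shiftz _ _ n%:Z x).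
have W0 n : (0 < #|lang (SFT H) n|)%N.
  by apply/card_gt0P; exists (word n x0); apply: mem_lang.
pose S n := finset.setX [set: 'I_T.+1]%SET (lang (SFT H) (n + T)).
have cardS n : (#|S n| <= T.+1 * #|lang (SFT H) T| * #|lang (SFT H) n|)%N.
  by rewrite cardsX cardsT card_ord -mulnA leq_mul2l /= mulnC WD.
exists (T.+1 * #|lang (SFT H) T|)%N; split.
- by rewrite muln_gt0 W0.
- move=> a b; apply: leq_trans (cardS _); rewrite -cardsX.
  apply: (@card_le_rel _ _ _ _ (fun p (q : 'I_T.+1 * _) => exists z,
    [/\ q.2 = word (a + b + T) z, p.1 = word a z & p.2 = word b (shiftz (a + q.1)%N%:Z z)])).
    move=> [_ _] /setXP[/= /langP[x Hx <-] /langP[x' Hx' <-]].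
    have [t [z Hz [tT zL zR _]]] := conn _ _ (SFT_shiftz a%:Z Hx) Hx'.
    exists (inord t, word (a + b + T) (shiftz (- a%:Z) z)).
      by apply/setXP; split; [rewrite inE | apply: mem_lang; apply: SFT_shiftz].
    exists (shiftz (- a%:Z) z); split => //=.
      apply: eq_word => i ia; rewrite /shiftz zL; last by lia.
      by rewrite /shiftz; congr (x _); lia.
    rewrite inordK //; apply: eq_word => i ib; rewrite -zR //.
    by rewrite /shiftz; congr (z _); lia.
  move=> [u1 u2] [v1 v2] [t _] _ _ [z [/= -> -> ->]] [z' [/= zz -> ->]].
  have tT := ltn_ord t.
  congr (_, _); apply: eq_word => i ia; first by apply: (word_eq zz); lia.
  by rewrite /shiftz; apply: (word_eq zz); lia.
- move=> m; exists (m * T)%N => n mn; apply: leq_trans (cardS _).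
  rewrite -{1}[m]card_ord -cardsT -cardsX.
  apply: (@card_le_rel _ _ _ _ (fun (p : 'I_m * _) (q : 'I_T.+1 * _) => exists z x, [/\ q.2 = word (n + T) z,
    avoids y L x, p.2 = word n x, (forall i : nat, (i < p.1 * T)%N -> z i%:Z = x i%:Z) &
    (forall i : nat, (p.1 * T <= i)%N -> z (i + q.1)%N%:Z = x i%:Z) /\
    exists2 k : nat, (k + L <= p.1 * T + q.1)%N & occurs y L z k%:Z])).
    move=> [i _] /setXP[/= _ /langP[x Xx <-]]; have Hx := Xx.1.
    have Hx' := SFT_shiftz (i * T)%N%:Z Hx.
    (* Up to a shift, [z] follows [x], leaves it at time i * T for a detour, and then resumes it
       where it left. *)
    have [t [z Hz [tT zL zR [k kt ko]]]] := conn _ _ Hx' Hx'.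
    exists (inord t, word (n + T) (shiftz (- (i * T)%N%:Z) z)).
      by apply/setXP; split; [rewrite inE | apply: mem_lang; apply: SFT_shiftz].
    exists (shiftz (- (i * T)%N%:Z) z), x; rewrite /= inordK //; split => //.
      move=> j ji; rewrite /shiftz zL; last by lia.
      by rewrite /shiftz; congr (x _); lia.
    split.
      move=> j ij; rewrite /shiftz.
      have -> : (j + t)%N%:Z - (i * T)%N%:Z = (j%:Z - (i * T)%N%:Z) + t%:Z by lia.
      by rewrite zR; [rewrite /shiftz; congr (x _); lia|lia].
    exists (k + i * T)%N; first by lia.
    by move=> j jL; rewrite -(ko j jL) /shiftz; congr (z _); lia.
  (* If i < i', the detour of [z] is over by time i' * T, until which [z'] follows the avoiding
     point [x']; equal words would give [x'] an occurrence. *)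
  have no_lt (i i' : 'I_m) (t : 'I_T.+1) (z z' x' : spoint N) :
      word (n + T) z = word (n + T) z' -> avoids y L x' ->
      (forall j : nat, (j < i' * T)%N -> z' j%:Z = x' j%:Z) ->
      (exists2 k : nat, (k + L <= i * T + t)%N & occurs y L z k%:Z) -> ~ (i < i')%N.
    move=> zz [_ nx'] z'L [k kt ko] ii'; apply: (nx' k) => j jL.
    have tT := ltn_ord t; have im := ltn_ord i'.
    have ii'T : (i.+1 * T <= i' * T)%N by rewrite leq_mul2r ii' orbT.
    have i'm : (i' * T <= m * T)%N by rewrite leq_mul2r (ltnW im) orbT.
    rewrite mulSn in ii'T.
    rewrite -(ko j jL) -!PoszD -z'L; last by lia.
    by apply: esym; apply: (word_eq zz); lia.
  move=> [i u] [i' u'] [t v] _ _ [z [x [/= -> Xx -> zL [zR zo]]]].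
  move=> [z' [x' [/= zz Xx' -> z'L [z'R z'o]]]].
  have ii' : i = i'.
    apply/val_inj/eqP; rewrite eqn_leq; apply/andP; split; rewrite leqNgt; apply/negP.
      exact: (no_lt i' i t z' z x).
    exact: (no_lt i i' t z z' x').
  subst i'; congr (_, _); apply: eq_word => j jn; have tT := ltn_ord t.
  have [ji|ij] := ltnP j (i * T).
    by rewrite -zL // -z'L //; apply: (word_eq zz); lia.
  by rewrite -zR // -z'R //; apply: (word_eq zz); lia.
Qed.

(** The factor 2 * C outweighs the loss of C per concatenation: at length k * n there are at least
    (2 V)^k words, V being the number of avoiding words of length n. The second C in the choice of m
    cancels the constant of [counting_bounds]. *)
Lemma avoids_card_gap : exists n C : nat, [/\ (0 < n)%N, (0 < C)%N,
  (2 * C * #|lang (avoids y L) n| <= #|lang (SFT H) n|)%N &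
  (forall k, (#|lang (SFT H) n| ^ k <= C ^ k * #|lang (SFT H) (k * n)|)%N)].
Proof.
have [C [C0 super gap]] := counting_bounds.
have [n nP] := gap (C * (2 * C))%N; exists n.+1, C; split => //.
  by have := nP n.+1 (leqnSn n); rewrite -mulnA leq_pmul2l.
elim=> [|k IHk].
  by rewrite !expn0 mul1n; apply/card_gt0P; exists (word _ x0); apply: mem_lang.
rewrite !expnS -mulnA mulSn; apply: leq_trans (leq_mul (leqnn _) IHk) _.
rewrite mulnCA [leqRHS]mulnCA leq_mul2l super orbT //.
Qed.

End Counting.
End Words.

(** * Topological entropy from word counts, and the entropy gap *)

Section Entropy.
Variables (R : realType) (N : nat) (H : 'M[bool]_N).
Implicit Types (x y z : spoint N) (X Y : set (spoint N)).

(** Points with the same symbols on [-k, n + k) stay within 2^-k during n steps. The code is split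
    at 0 because [word] reads coordinates from 0 on. *)
Lemma size_separated X Y n k (eps : R) E :
  X `<=` Y -> 2%:R ^- k <= eps -> separated X n eps E ->
  (size E <= N ^ k * #|lang Y (n + k)|)%N.
Proof.
move=> XY keps [uE [EX Esep]].
have eps0 : 0 <= eps by apply: le_trans keps; rewrite invr_ge0 exprn_ge0.
pose f x := (word k (shiftz (- k%:Z) x), word (n + k) x).
have uf : uniq (map f E).
  rewrite map_inj_in_uniq // => x y xE yE [f1 f2].
  apply/eqP; apply: contraT => xy; have := Esep x y xE yE xy.
  rewrite ltNge => /negP[]; apply: bigmax_le => // j _.
  apply: le_trans keps; apply: sdist_agree; rewrite !iter_shift => i ik; rewrite /shiftz.
  have jn := ltn_ord j.
  case: (leP 0 (i + j%:Z)) => ij.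
    have -> : i + j%:Z = (absz (i + j%:Z))%:Z by lia.
    by apply: (word_eq f2); lia.
  have := @word_eq _ _ _ _ (absz (i + j%:Z + k%:Z)) f1; rewrite /shiftz.
  have -> : (absz (i + j%:Z + k%:Z))%:Z - k%:Z = i + j%:Z by lia.
  by apply; lia.
rewrite -(size_map f) -(card_uniqP uf).
have -> : (N ^ k)%N = #|[set: {ffun 'I_k -> 'I_N}]%SET|.
  by rewrite cardsT card_ffun !card_ord.
rewrite -cardsX; apply: subset_leq_card; apply/fintype.subsetP => _ /mapP[x xE ->].
by apply/setXP; split; [rewrite inE | apply: mem_lang; apply/XY/EX].
Qed.

Lemma sep_num_le X Y n k (eps : R) :
  X `<=` Y -> 2%:R ^- k <= eps -> sep_num X n eps <= (N ^ k * #|lang Y (n + k)|)%N%:R.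
Proof.
move=> XY keps; apply: ge_sup.
  by exists 0; exists [::] => //; split.
by move=> _ [E sE <-]; rewrite ler_nat; apply: size_separated sE.
Qed.

(** Points with distinct n-words differ at coordinate 0 after fewer than n shifts, so their Bowen
    distance exceeds 1/2. *)
Lemma sep_num_ge X n : #|lang X n|%:R <= sep_num X n (2^-1 : R).
Proof.
have [->|[u0 u0X]] := set_0Vmem (lang X n).
  rewrite cards0; apply: ub_le_sup.
    exists (N ^ 1 * #|lang X (n + 1)|)%N%:R => _ [E sE <-].
    by rewrite ler_nat; apply: size_separated sE; rewrite // expr1.
  by exists [::] => //; split.
have [x0 Xx0 _] := langP _ _ u0X.
have [f fP] : {f : {ffun 'I_n -> 'I_N} -> spoint N &
    forall u, u \in lang X n -> X (f u) /\ word n (f u) = u}.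
  apply: (@choice _ _ (fun u x => u \in lang X n -> X x /\ word n x = u)) => u.
  have [/langP[x Xx xu]|_] := boolP (u \in lang X n); last by exists x0.
  by exists x.
apply: ub_le_sup.
  exists (N ^ 1 * #|lang X (n + 1)|)%N%:R => _ [E sE <-].
  by rewrite ler_nat; apply: size_separated sE; rewrite // expr1.
exists (map f (enum (lang X n))); last by rewrite size_map -cardE.
split; [|split].
- rewrite map_inj_in_uniq ?enum_uniq // => u v; rewrite !mem_enum => uX vX fuv.
  by rewrite -(fP u uX).2 -(fP v vX).2 fuv.
- by move=> _ /mapP[u uX ->]; rewrite mem_enum in uX; apply: (fP u uX).1.
move=> _ _ /mapP[u uX ->] /mapP[v vX ->]; rewrite !mem_enum in uX vX => fuv.
have [i ui] : exists i : 'I_n, u i != v i.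
  apply/existsP; apply: contraR fuv; rewrite negb_exists => /forallP uv.
  by apply/eqP; congr f; apply/ffunP => i; have := uv i; rewrite negbK => /eqP.
apply: (@lt_le_trans _ _ (sdist R (iter i (@Defs.shift N) (f u)) (iter i (@Defs.shift N) (f v)))).
  rewrite ltNge; apply: contra ui => le2; apply/eqP.
  have ag : agree 0 (iter i (@Defs.shift N) (f u)) (iter i (@Defs.shift N) (f v)).
    apply: (@agree_sdist R); rewrite expr0 invr1; apply: le_lt_trans le2 _.
    by rewrite invf_lt1 // ltr1n.
  have := ag 0 isT; rewrite !iter_shift /shiftz !add0r => fi.
  by rewrite -(fP u uX).2 -(fP v vX).2 !ffunE.
exact: (le_bigmax _ (fun k : 'I_n => sdist R (iter k (@Defs.shift N) (f u)) (iter k (@Defs.shift N) (f v)))).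
Qed.

Lemma limn_esup_le (u : nat -> \bar R) n c :
  (forall k, (n <= k)%N -> u k <= c)%E -> (limn_esup u <= c)%E.
Proof.
move=> uc; apply: (@le_trans _ _ (ereal_sup (u @` [set k | (n <= k)%N]))).
  by apply: ereal_inf_lbound; exists [set k | (n <= k)%N] => //; exists n.
by apply: ge_ereal_sup => _ [k nk <-]; apply: uc.
Qed.

Lemma limn_esup_ge (u : nat -> \bar R) c :
  (forall n, exists2 k, (n <= k)%N & c <= u k)%E -> (c <= limn_esup u)%E.
Proof.
move=> cu; apply: le_ereal_inf_tmp => _ [V [n _ nV] <-].
have [k nk ck] := cu n; apply: le_trans ck _.
by apply: ereal_sup_ubound; exists k => //; apply: nV.
Qed.

Lemma htop_ge X n c : (0 < n)%N -> 1 <= c ->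
  (forall k, c ^+ k <= #|lang X (k * n)|%:R) ->
  ((ln c / n%:R)%:E <= htop R X)%E.
Proof.
move=> n0 c1 cX.
apply: (@le_trans _ _ (limn_esup
  (fun m : nat => ((m%:R)^-1 * ln (sep_num X m (2^-1 : R)))%:E))); last first.
  by apply: ereal_sup_ubound; exists 2^-1 => //=; rewrite invr_gt0.
apply: limn_esup_ge => m; exists (m.+1 * n)%N; first by rewrite -[m in (m <= _)%N]muln1 leq_mul.
rewrite lee_fin natrM ler_pdivrMr ?ltr0n //; set S := ln (sep_num _ _ _).
have -> : (m.+1%:R * n%:R)^-1 * S * n%:R = S / m.+1%:R.
  by rewrite invfM mulrAC mulfVK 1?mulrC // pnatr_eq0 -lt0n.
rewrite ler_pdivlMr ?ltr0n // mulr_natr -lnXn ?(lt_le_trans _ c1) //.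
have cm0 : 0 < c ^+ m.+1 by rewrite exprn_gt0 // (lt_le_trans _ c1).
rewrite ler_ln ?posrE //; last first.
  by apply: lt_le_trans cm0 _; apply: le_trans (cX _) (sep_num_ge _ _).
exact: le_trans (cX _) (sep_num_ge _ _).
Qed.

(** Rounding the length m + k up to a multiple of n and the factor N^k cost only a constant c in the
    logarithm, absorbed by m * del for large m. *)
Lemma htop_le X Y n V (del : R) : X `<=` Y -> (0 < n)%N -> (0 < V)%N -> 0 < del ->
  (forall k, (#|lang Y (k * n)| <= V ^ k)%N) ->
  (htop R X <= (ln V%:R / n%:R + del)%:E)%E.
Proof.
move=> XY n0 V0 del0 YV; apply: ge_ereal_sup => _ [eps /= eps0 <-].
have [k keps] := exp2V_small eps0.
have V1 : 1 <= V%:R :> R by rewrite ler1n.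
have lnV0 : 0 <= ln (V%:R : R) by rewrite ln_ge0.
(* The maximum keeps the logarithm nonnegative even if N = 0. *)
pose M : nat := maxn 1 (N ^ k); pose c : R := ln M%:R + (k%:R / n%:R + 1) * ln V%:R.
have M0 : 1 <= M%:R :> R by rewrite ler1n leq_maxl.
have lnM0 : 0 <= ln (M%:R : R) by rewrite ln_ge0.
have c0 : 0 <= c by rewrite addr_ge0 // mulr_ge0 // addr_ge0 // divr_ge0.
apply: (@limn_esup_le _ (Num.bound (c / del)).+1) => m mc; rewrite lee_fin.
have m0 : 0 < m%:R :> R by rewrite ltr0n; apply: leq_trans mc.
suff le_m : ln (sep_num X m eps) <= m%:R * (ln V%:R / n%:R) + c.
  rewrite ler_pdivrMl //; apply: le_trans le_m _; rewrite mulrDr lerD2l.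
  rewrite -ler_pdivrMr //; apply: ltW; apply: (@lt_le_trans _ _ (Num.bound (c / del))%:R).
    by rewrite archi_boundP // divr_ge0 // ltW.
  by rewrite ler_nat ltnW.
have [s0|s0] := lerP (sep_num X m eps) 0.
  by rewrite ln0 // addr_ge0 // mulr_ge0 ?divr_ge0 // ltW.
have le_s : sep_num X m eps <= M%:R * V%:R ^+ ((m + k) %/ n).+1.
  apply: le_trans (sep_num_le m XY (ltW keps)) _.
  rewrite -natrX -natrM ler_nat leq_mul ?leq_maxr //.
  apply: leq_trans (YV _); apply: card_lang_mono.
  by rewrite ltnW // ltn_ceil.
have V00 : 0 < V%:R :> R by rewrite ltr0n.
have M00 : 0 < M%:R :> R by apply: lt_le_trans M0.
apply: (@le_trans _ _ (ln (M%:R * V%:R ^+ ((m + k) %/ n).+1))).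
  by rewrite ler_ln ?posrE // (lt_le_trans s0).
rewrite lnM ?posrE ?exprn_gt0 // lnXn // /c addrCA lerD2l -[_ *+ _.+1]mulr_natl.
rewrite [leRHS](_ : _ = ((m + k)%:R / n%:R + 1) * ln V%:R); last first.
  by rewrite natrD; field; rewrite pnatr_eq0 -lt0n.
rewrite ler_wpM2r // -natr1 lerD2r ler_pdivlMr ?ltr0n //.
by rewrite -natrM ler_nat leq_trunc_div.
Qed.

(** At length k * n there are at most V^k avoiding words and at least (2 V)^k words, a gap of ln 2 /
    n; half of it is spent on the error term of [htop_le]. *)
Lemma avoids_htop_lt y L : transitive_SFT R H -> (0 < htop R (SFT H))%E -> SFT H y ->
  exists2 h : \bar R, (h < htop R (SFT H))%E &
    forall X, X `<=` avoids H y L -> (htop R X <= h)%E.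
Proof.
move=> tr hpos Hy; have [x0 Hx0 rec] := transitive_recurrent tr.
have [n [C [n0 C0 gap super]]] := avoids_card_gap L Hx0 rec Hy.
set V := #|lang (avoids H y L) n| in gap; set W := #|lang (SFT H) n| in gap super.
have bound X del : X `<=` avoids H y L -> 0 < del ->
    (htop R X <= (ln (maxn 1 V)%:R / n%:R + del)%:E)%E.
  move=> XA del0; apply: (@htop_le _ (avoids H y L)) => // [|k]; first exact: leq_maxl.
  apply: leq_trans (card_langX _ _ _) _; first by move=> x m; apply: avoids_shift.
  by case: k => // k; rewrite leq_exp2r // leq_maxr.
(* If no word of length n avoids the block, the bound is [del] alone, and positive entropy leaves
   room for it. *)
have [V0|V0] := posnP V.
  have [del del0 delh] : exists2 del : R, 0 < del & (del%:E < htop R (SFT H))%E.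
    case: (htop R (SFT H)) hpos => [h||] //.
      by rewrite lte_fin => h0; exists (h / 2); rewrite ?lte_fin; lra.
    by exists 1 => //; rewrite ltry.
  exists del%:E => // X /bound/(_ del0).
  by rewrite V0 maxn0 ln1 mul0r add0r.
exists (ln V%:R / n%:R + ln 2 / (2 * n%:R))%:E; last first.
  move=> X /bound; rewrite (maxn_idPr V0); apply.
  by rewrite divr_gt0 ?ln_gt0 ?mulr_gt0 ?ltr0n ?ltr1n.
apply: (@lt_le_trans _ _ (ln (2 * V)%:R / n%:R)%:E).
  have n00 : (0 : R) < n%:R by rewrite ltr0n.
  rewrite lte_fin natrM lnM ?posrE ?ltr0n // [ltRHS]mulrDl invfM [_ * (2^-1 * _)]mulrCA.
  have : 0 < ln 2 / n%:R :> R by rewrite divr_gt0 ?ln_gt0 ?ltr1n.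
  by lra.
apply: htop_ge => // [|k]; first by rewrite ler1n muln_gt0.
rewrite -natrX ler_nat -(leq_pmul2l (_ : 0 < C ^ k)%N) ?expn_gt0 ?C0 //.
apply: leq_trans (super k); rewrite -expnMn; case: k => // k.
by rewrite leq_exp2r // mulnA (mulnC C).
Qed.

(** A set of entropy above the gap value cannot avoid the window [-r, r] of [y]. The point is moved
    by -r because occurrences are read from coordinate 0. *)
Lemma htop_cvg_meets (X : nat -> set (spoint N)) y r m :
  transitive_SFT R H -> (0 < htop R (SFT H))%E -> (forall n, X n `<=` SFT H) ->
  (fun n => htop R (X n)) @ \oo --> htop R (SFT H) -> SFT H y ->
  exists2 n, (m <= n)%N & exists2 x, X n x & exists i : nat, agree r (shiftz i%:Z x) y.
Proof.
move=> tr hpos XH cvX Hy.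
have [h hlt hP] := avoids_htop_lt (2 * r).+1 tr hpos (SFT_shiftz (- r%:Z) Hy).
have /cvX[n0 _ n0P] : nbhs (htop R (SFT H)) [set z | (h < z)%E].
  by apply: open_nbhs_nbhs; split => //; apply: open_ereal_gt_ereal.
exists (maxn m n0); first exact: leq_maxl.
have hX : (h < htop R (X (maxn m n0)))%E by apply: n0P; rewrite /= leq_maxr.
have : ~ (X (maxn m n0) `<=` avoids H (shiftz (- r%:Z) y) (2 * r).+1).
  by move=> /hP; rewrite leNgt hX.
move=> /existsNP[x /not_implyP[Xx nax]]; exists x => //.
have [i oi] : exists i : nat, occurs (shiftz (- r%:Z) y) (2 * r).+1 x i%:Z.
  by apply: contra_notP nax => nex; split => [|i oi]; [apply: XH Xx | apply: nex; exists i].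
exists (i + r)%N => k kr; have := oi (absz (k + r%:Z)); rewrite /shiftz.
have -> : i%:Z + (absz (k + r%:Z))%:Z = k + (i + r)%N%:Z by lia.
have -> : (absz (k + r%:Z))%:Z - r%:Z = k by lia.
by apply; lia.
Qed.

End Entropy.

(** * Perturbation of cocycles and the uniform bound *)

Section Cocycles.
Variables (R : realType) (N : nat) (H : 'M[bool]_N) (d : nat).
Implicit Types (x y z : spoint N) (A B : spoint N -> 'M[R]_d).

Lemma cocnD A n m x : cocn A (n + m) x = cocn A n (shiftz m%:Z x) *m cocn A m x.
Proof.
elim: n => [|n IHn] /=; first by rewrite mul1mx.
by rewrite IHn mulmxA !iter_shift shiftzD -PoszD.
Qed.

Lemma cocn1 A x : cocn A 1 x = A x.
Proof. by rewrite /= mulmx1. Qed.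

Lemma cocn_unit A n x : GL_valued H A -> SFT H x -> cocn A n x \in unitmx.
Proof.
move=> GA Hx; elim: n => [|n IHn] /=; first exact: unitmx1.
by rewrite unitmx_mul IHn andbT iter_shift; apply: GA; apply: SFT_shiftz.
Qed.

Definition locally_continuous A := forall y, SFT H y -> forall e : R, 0 < e ->
  exists r, forall x, SFT H x -> agree r x y -> nm (A x - A y) <= e.

(** The Hoelder condition on cylinders, with rho = 2^-alpha; summed errors become geometric
    series. *)
Definition exp_varying A (C rho : R) := forall r x y, SFT H x -> SFT H y ->
  agree r x y -> nm (A x - A y) <= C * rho ^+ r.

Lemma exp_small (C rho e : R) : 0 <= rho -> rho < 1 -> 0 < e ->
  exists r, C * rho ^+ r <= e.
Proof.
move=> rho0 rho1 e0.
have rhoN : `|rho| < 1 by rewrite ger0_norm.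
have /cvgrPdist_le/(_ _ e0)[r _ /(_ r (leqnn _))] := cvg_geometric C rhoN.
by rewrite /= sub0r normrN => le_e; exists r; apply: le_trans (ler_norm _) le_e.
Qed.

Lemma sum_geometric_le (rho : R) n : 0 <= rho -> rho < 1 ->
  \sum_(j < n) rho ^+ j <= (1 - rho)^-1.
Proof.
move=> rho0 rho1; have r1 : 0 < 1 - rho by rewrite subr_gt0.
rewrite -[leRHS]mul1r ler_pdivlMr // mulrC -[leLHS]opprK -mulNr opprB -subrX1.
by rewrite opprB lerBlDr lerDl exprn_ge0.
Qed.

Lemma holder_exp_varying alpha A : 0 < alpha -> holder H alpha A ->
  exists C rho : R, [/\ 0 <= C, 0 <= rho, rho < 1 & exp_varying A C rho].
Proof.
move=> a0 [C AC]; exists ((d * d)%:R * `|C|), (2^-1 `^ alpha); split.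
- by rewrite mulr_ge0.
- exact: powR_ge0.
- rewrite -[ltRHS]/((fun=> 1) alpha) -(powR1 R); apply: gt0_ltr_powR => //.
    by rewrite nnegrE invr_ge0.
    by rewrite nnegrE.
  by rewrite invf_lt1 // ltr1n.
move=> r x y Hx Hy xy; apply: le_trans (nm_le_opnorm _) _.
rewrite -mulrA ler_wpM2l //; apply: le_trans (AC x y Hx Hy) _.
apply: (@le_trans _ _ (`|C| * sdist R x y `^ alpha)).
  by rewrite ler_wpM2r ?powR_ge0 // ler_norm.
rewrite ler_wpM2l //.
rewrite -[X in _ <= X]powR_mulrn ?powR_ge0 // powRAC powR_mulrn ?invr_ge0 //.
have le2 := sdist_agree R xy.
have sd0 : 0 <= sdist R x y.
  rewrite /sdist; case: pselect => [[i xyi]|ne] //=.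
  apply: (@le_trans _ _ (2%:R ^- `|i|%N)); first by rewrite invr_ge0 exprn_ge0.
  apply: ub_le_sup; first by exists 1; apply: sdist_set_ubound.
  by exists i.
apply: ge0_ler_powR; rewrite ?nnegrE ?exprn_ge0 ?invr_ge0 ?(ltW a0) //.
by rewrite exprVn.
Qed.

Lemma exp_varying_continuous A C rho : 0 <= rho -> rho < 1 ->
  exp_varying A C rho -> locally_continuous A.
Proof.
move=> rho0 rho1 AC y Hy e e0; have [r re] := exp_small C rho0 rho1 e0.
by exists r => x Hx xy; apply: le_trans (AC r x y Hx Hy xy) re.
Qed.

Lemma locally_continuous_on_SFT A : locally_continuous A -> continuous_on_SFT H A.
Proof.
move=> cA x Hx e e0; have e20 : 0 < e / 2 by rewrite divr_gt0.
have [r rP] := cA x Hx _ e20; exists (2%:R ^- r); first by rewrite invr_gt0 exprn_gt0.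
move=> y Hy /agree_sdist/agree_sym xy; apply: le_lt_trans (opnorm_le_nm _) _.
by apply: le_lt_trans (rP y Hy xy) _; rewrite ltr_pdivrMr // ltr_pMr // ltr1n.
Qed.

(** The radius and the tolerance depend on [A], [y], [m] and [e] only, so one choice serves all
    nearby cocycles. *)
Lemma cocn_close A y m (e : R) : locally_continuous A -> SFT H y -> 0 < e ->
  exists r, exists2 del : R, 0 < del & forall B x, SFT H x -> agree r x y ->
    (forall z, SFT H z -> nm (B z - A z) <= del) ->
    nm (cocn B m x - cocn A m y) <= e.
Proof.
move=> cA Hy; elim: m e => [|m IHm] e e0 /=.
  by exists 0%N, 1 => // B x *; rewrite subrr nm0 ltW.
set a := A (iter m _ y); set c := cocn A m y.
have Hmy : SFT H (shiftz m%:Z y) by apply: SFT_shiftz.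
have na0 : 0 < nm a + 1 by rewrite ltr_wpDl // nm_ge0.
have nc0 : 0 < nm c + 1 by rewrite ltr_wpDl // nm_ge0.
(* Each of the two terms of the product estimate gets e / 2; [e1] is counted twice, for [B] against
   [A] and for the continuity of [A]. *)
pose e1 := e / (4 * (nm c + 1)); pose e2 := Num.min 1 (e / (2 * (nm a + 1))).
have e10 : 0 < e1 by rewrite divr_gt0 // mulr_gt0.
have e20 : 0 < e2 by rewrite lt_min ltr01 divr_gt0 // mulr_gt0.
have [r1 [del1 del10 P1]] := IHm _ e20; have [r2 P2] := cA _ Hmy _ e10.
exists (maxn r1 (r2 + m)), (Num.min del1 e1); first by rewrite lt_min del10.
move=> B x Hx xy BA.
have Hmx : SFT H (shiftz m%:Z x) by apply: SFT_shiftz.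
have le1 : nm (cocn B m x - c) <= e2.
  apply: P1 => //; first by apply: agree_le xy; apply: leq_maxl.
  by move=> z /BA BAz; apply: le_trans BAz _; rewrite ge_min lexx.
have le2 : nm (B (iter m (@Defs.shift N) x) - a) <= e1 + e1.
  rewrite /a !iter_shift; apply: le_trans (nm_tri _ (A (shiftz m%:Z x)) _) _.
  apply: lerD; first by apply: le_trans (BA _ Hmx) _; rewrite ge_min lexx orbT.
  apply: P2 => //; apply: agree_shiftz xy; rewrite absz_nat; exact: leq_maxr.
rewrite -[_ - _](subrKA (a *m cocn B m x)) -mulmxBl -mulmxBr.
have e21 : e2 <= 1 by rewrite ge_min lexx.
have e2e : e2 <= e / (2 * (nm a + 1)) by rewrite ge_min lexx orbT.
have leB : nm (cocn B m x) <= nm c + 1.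
  by apply: le_trans (nm_leB _ c) _; rewrite lerD2l; apply: le_trans e21.
apply: le_trans (nmD _ _) _.
apply: (@le_trans _ _ ((e1 + e1) * (nm c + 1) + (nm a + 1) * (e / (2 * (nm a + 1))))).
  apply: lerD; first exact: nmM_le.
  by apply: nmM_le; [rewrite lerDl | apply: le_trans e2e].
suff -> : (e1 + e1) * (nm c + 1) + (nm a + 1) * (e / (2 * (nm a + 1))) = e by [].
by rewrite /e1; field; rewrite !gt_eqF.
Qed.

(** Resolvent identity. The unknown norm of [invmx M] returns on the right with a factor e, and
    disappears when e tends to 0 with M fixed. *)
Lemma nm_inv_close (M P : 'M[R]_d) (c e : R) : M \in unitmx -> P \in unitmx ->
  nm (P - M) <= e -> nm (invmx P) <= c -> nm (invmx M) <= c + nm (invmx M) * e * c.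
Proof.
move=> uM uP PM Pc; apply: le_trans (nm_leB _ (invmx P)) _; apply: lerD => //.
have -> : invmx M - invmx P = invmx M *m (P - M) *m invmx P.
  by rewrite mulmxBr mulmxBl mulVmx // mul1mx -mulmxA mulmxV // mulmx1.
by apply: nmM_le => //; apply: nmM_le.
Qed.

Lemma eps_le (a b c : R) : 0 <= c -> (forall e, 0 < e -> a <= b + c * e) -> a <= b.
Proof.
move=> c0 ab; apply/ler_addgt0Pr => e e0.
have c10 : 0 < c + 1 by rewrite ltr_wpDl.
have e0' : 0 < e / (c + 1) by rewrite divr_gt0.
apply: le_trans (ab _ e0') _; rewrite lerD2l mulrCA ger_pMr //.
by rewrite ler_pdivrMr // mul1r lerDl.
Qed.

(** A product along the orbit is a quotient of two products started at [x]: A_n(sigma^i x) =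
    A_{n+i}(x) A_i(x)^{-1}. Hence the square. *)
Lemma Bset_orbit_bound A kappa x i n : GL_valued H A -> Bset H A kappa x ->
  let c := ((d * d)%:R * kappa) ^+ 2 in let M := cocn A n (shiftz i%:Z x) in
  nm M <= c /\ nm (invmx M) <= c.
Proof.
move=> GA [Hx Bx] c M.
have bd m : nm (cocn A m x) <= (d * d)%:R * kappa /\
            nm (invmx (cocn A m x)) <= (d * d)%:R * kappa.
  have [B1 B2] := Bx m%:Z.
  by split; apply: le_trans (nm_le_opnorm _) _; rewrite ler_wpM2l.
have ui := cocn_unit i GA Hx; have uM := cocn_unit n GA (SFT_shiftz i%:Z Hx).
have ME : M = cocn A (n + i) x *m invmx (cocn A i x) by rewrite cocnD mulmxK.
have MVE : invmx M = cocn A i x *m invmx (cocn A (n + i) x).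
  have MX : M *m (cocn A i x *m invmx (cocn A (n + i) x)) = 1%:M.
    by rewrite {1}ME !mulmxA mulmxKV // mulmxV // cocn_unit.
  by rewrite -[RHS]mul1mx -(mulVmx uM) -mulmxA MX mulmx1.
split; first by rewrite ME /c expr2; apply: nmM_le; [apply: (bd _).1|apply: (bd _).2].
by rewrite MVE /c expr2; apply: nmM_le; [apply: (bd _).1|apply: (bd _).2].
Qed.

(** Each A_n(y) is a limit of products of the A^(p) started near [y] on orbits of points of B(A^(p),
    kappa); these obey a bound independent of n, y and p. *)
Lemma uniformly_bounded A (An : nat -> spoint N -> 'M[R]_d) kappa :
  transitive_SFT R H -> (0 < htop R (SFT H))%E ->
  locally_continuous A -> GL_valued H A -> (forall n, GL_valued H (An n)) ->
  (fun n => dC0 H A (An n)) @ \oo --> 0%E ->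
  (fun n => htop R (Bset H (An n) kappa)) @ \oo --> htop R (SFT H) ->
  exists2 k : R, 1 <= k & forall n x, SFT H x ->
    nm (cocn A n x) <= k /\ nm (invmx (cocn A n x)) <= k.
Proof.
move=> tr hpos cA GA GAn AnA hB.
set c := ((d * d)%:R * kappa) ^+ 2; have c0 : 0 <= c by rewrite sqr_ge0.
have close n y e : SFT H y -> 0 < e -> exists2 M, M \in unitmx &
    [/\ nm (M - cocn A n y) <= e, nm M <= c & nm (invmx M) <= c].
  move=> Hy e0; have [r [del del0 P]] := cocn_close n cA Hy e0.
  have dd0 : 0 < (d * d)%:R + 1 :> R by rewrite ltr_wpDl.
  have del'0 : 0 < del / ((d * d)%:R + 1) by rewrite divr_gt0.
  have /AnA[m _ mP] : nbhs (0%E : \bar R) [set z | (z < (del / ((d * d)%:R + 1))%:E)%E].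
    by apply: open_nbhs_nbhs; split; [apply: open_ereal_lt_ereal | rewrite /= lte_fin].
  have [p mp [x Bx [i ixy]]] := htop_cvg_meets r m tr hpos
    (fun n x => (fun Bx : Bset H (An n) kappa x => Bx.1)) hB Hy.
  have Hx := SFT_shiftz i%:Z Bx.1.
  exists (cocn (An p) n (shiftz i%:Z x)); first exact: cocn_unit.
  have [M1 M2] := Bset_orbit_bound i n (GAn p) Bx; split => //.
  apply: P => // z Hz; rewrite nmB; apply: le_trans (nm_le_opnorm _) _.
  apply: (@le_trans _ _ (((d * d)%:R + 1) * opnorm (A z - An p z))).
    by rewrite ler_wpM2r ?opnorm_ge0 // lerDl.
  rewrite -ler_pdivlMl // mulrC -lee_fin; apply: ltW; apply: le_lt_trans (mP p mp).
  by apply: ereal_sup_ubound; exists z.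
exists (c + 1); first by rewrite lerDr.
move=> n x Hx; have uA := cocn_unit n GA Hx; split.
  apply: (@le_trans _ _ c); last by rewrite lerDl.
  apply: (@eps_le _ _ 1) => // e e0; have [M _ [MA Mc _]] := close n x e Hx e0.
  by rewrite mul1r; apply: le_trans (nm_leB _ M) _; rewrite nmB; apply: lerD.
apply: (@le_trans _ _ c); last by rewrite lerDl.
apply: (@eps_le _ _ (nm (invmx (cocn A n x)) * c)); first by rewrite mulr_ge0 ?nm_ge0.
move=> e e0; have [M uM [MA _ Mc]] := close n x e Hx e0.
by rewrite mulrAC; apply: nm_inv_close MA Mc.
Qed.

End Cocycles.

(** * Bounded cocycles: shadowing, nearly trivial loops, limit sets *)

Lemma pigeonhole_mx (R : realType) (d : nat) (M : nat -> 'M[R]_d) (k e : R) :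
  (forall n, nm (M n) <= k) -> 0 < e ->
  exists i j : nat, (i < j)%N /\ nm (M j - M i) <= e.
Proof.
move=> Mk e0; pose del := e / ((d * d)%:R + 1).
have dd0 : 0 < (d * d)%:R + 1 :> R by rewrite ltr_wpDl.
have del0 : 0 < del by rewrite divr_gt0.
pose q n (p : 'I_d * 'I_d) := (M n p.1 p.2 + k) / del.
have Mk' n p : - k <= M n p.1 p.2 <= k.
  by rewrite -ler_norml; apply: le_trans (nm_entry _ _ _) (Mk n).
have q0 n p : 0 <= q n p.
  by rewrite divr_ge0 ?(ltW del0) //; have /andP[] := Mk' n p; lra.
pose b := Num.truncn (2 * k / del).
have qb n p : (Num.truncn (q n p) < b.+1)%N.
  rewrite ltnS; apply: le_truncn; rewrite ler_pM2r ?invr_gt0 //.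
  by have /andP[] := Mk' n p; lra.
pose code n : {ffun 'I_d * 'I_d -> 'I_b.+1} := [ffun p => inord (Num.truncn (q n p))].
have [i [j [ij cij]]] : exists i j : nat, (i < j)%N /\ code i = code j.
  pose T := {ffun 'I_d * 'I_d -> 'I_b.+1}.
  have : ~~ injectiveb (fun i : 'I_#|T|.+1 => code i).
    apply/negP => /injectiveP/leq_card; rewrite card_ord => le_card.
    by move: le_card; rewrite ltnn.
  move=> /injectivePn[i [j ij cij]].
  have [lij|lji|/val_inj eij] := ltngtP i j; last by rewrite eij eqxx in ij.
    by exists i, j.
  by exists j, i.
exists i, j; split => //.
have close p : `|M j p.1 p.2 - M i p.1 p.2| <= del.
  have /ffunP/(_ p) := cij; rewrite !ffunE => /(congr1 (@nat_of_ord _)).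
  rewrite !inordK // => tE.
  have /andP[l1 u1] := truncn_itv (q0 i p).
  have /andP[l2 u2] := truncn_itv (q0 j p).
  rewrite tE in l1 u1.
  have -> : M j p.1 p.2 - M i p.1 p.2 = (q j p - q i p) * del.
    by rewrite /q; field; rewrite gt_eqF.
  rewrite normrM (ger0_norm (ltW del0)) ger_pMl // ler_norml.
  by rewrite -natr1 in u1 u2; lra.
apply: (@le_trans _ _ ((d * d)%:R * del)); last first.
  by rewrite /del mulrCA ger_pMr // ler_pdivrMr // mul1r lerDl.
by apply: nm_le_entries => u v; rewrite !mxE; apply: (close (u, v)).
Qed.

Section BoundedCocycle.
Variables (R : realType) (N : nat) (H : 'M[bool]_N) (d : nat).
Variables (A : spoint N -> 'M[R]_d) (k C rho : R) (x0 : spoint N).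
Hypotheses (GA : GL_valued H A) (k1 : 1 <= k).
Hypothesis bd : forall n x, SFT H x ->
  nm (cocn A n x) <= k /\ nm (invmx (cocn A n x)) <= k.
Hypotheses (C0 : 0 <= C) (rho0 : 0 <= rho) (rho1 : rho < 1).
Hypothesis varA : exp_varying H A C rho.
Hypotheses (Hx0 : SFT H x0) (rec : recurrent H x0).
Implicit Types (x y z : spoint N) (g : 'M[R]_d).

Let k0 : 0 < k. Proof. exact: lt_le_trans k1. Qed.

(** The interpolating product [D j] follows [x] for j steps and [y] afterwards; neighbours differ in
    one factor, between two bounded products. *)
Lemma cocn_telescope n x y : SFT H x -> SFT H y -> nm (cocn A n x - cocn A n y) <=
  k ^+ 2 * \sum_(j < n) nm (A (shiftz j%:Z x) - A (shiftz j%:Z y)).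
Proof.
move=> Hx Hy.
pose D j := cocn A (n - j) (shiftz j%:Z y) *m cocn A j x.
have D0 : D 0%N = cocn A n y by rewrite /D subn0 shiftz0 mulmx1.
have Dn : D n = cocn A n x by rewrite /D subnn mul1mx.
have claim j : (j <= n)%N -> nm (D j - D 0%N) <=
    k ^+ 2 * \sum_(i < j) nm (A (shiftz i%:Z x) - A (shiftz i%:Z y)).
  elim: j => [|j IHj] jn; first by rewrite subrr nm0 big_ord0 mulr0.
  rewrite big_ord_recr /= mulrDr [leRHS]addrC; apply: le_trans (nm_tri _ (D j) _) _.
  apply: lerD; last by apply: IHj; apply: ltnW.
  have -> : D j.+1 - D j = cocn A (n - j.+1) (shiftz j.+1%:Z y) *m
      (A (shiftz j%:Z x) - A (shiftz j%:Z y)) *m cocn A j x.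
    rewrite /D (_ : (n - j = n - j.+1 + 1)%N); last by lia.
    rewrite cocnD cocn1 shiftzD (_ : 1%:Z + j%:Z = j.+1%:Z); last by lia.
    by rewrite /= iter_shift mulmxBr mulmxBl !mulmxA.
  have b1 := (bd (n - j.+1) (SFT_shiftz j.+1%:Z Hy)).1.
  have b2 := (bd j Hx).1.
  rewrite expr2 mulrAC.
  by apply: nmM_le => //; apply: nmM_le.
by have := claim n (leqnn n); rewrite D0 Dn.
Qed.

Let K1 := k ^+ 2 * (C * (1 - rho)^-1).

(** The window of agreement grows by one at each step, so the errors sum to a geometric series,
    uniformly in n. *)
Lemma cocn_close_future n r x y : SFT H x -> SFT H y ->
  (forall i : int, - r%:Z <= i -> x i = y i) ->
  nm (cocn A n x - cocn A n y) <= K1 * rho ^+ r.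
Proof.
move=> Hx Hy xy; apply: le_trans (cocn_telescope n Hx Hy) _.
rewrite /K1 -[leRHS]mulrA ler_wpM2l ?exprn_ge0 ?(ltW k0) //.
apply: (@le_trans _ _ (C * (rho ^+ r * \sum_(j < n) rho ^+ j))).
  rewrite !mulr_sumr; apply: ler_sum => j _; rewrite -exprD.
  apply: (varA (r := (r + j)%N)); try exact: SFT_shiftz.
  by move=> i ir; rewrite /shiftz; apply: xy; lia.
rewrite -[leRHS]mulrA ler_wpM2l // mulrC ler_wpM2r ?exprn_ge0 //; exact: sum_geometric_le.
Qed.

Lemma cocn_close_past n r x y : SFT H x -> SFT H y ->
  (forall i : int, i <= n%:Z + r%:Z -> x i = y i) ->
  nm (cocn A n x - cocn A n y) <= K1 * rho ^+ r.
Proof.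
move=> Hx Hy xy; apply: le_trans (cocn_telescope n Hx Hy) _.
rewrite /K1 -[leRHS]mulrA ler_wpM2l ?exprn_ge0 ?(ltW k0) //.
apply: (@le_trans _ _ (C * (rho ^+ r * \sum_(j < n) rho ^+ j))).
  (* Here the window shrinks with time, so the series is summed backwards. *)
  rewrite [X in _ <= _ * (_ * X)](reindex_inj rev_ord_inj) /=.
  rewrite !mulr_sumr; apply: ler_sum => j _; rewrite -exprD.
  have jn := ltn_ord j.
  apply: (varA (r := (r + (n - j.+1))%N)); try exact: SFT_shiftz.
  by move=> i ir; rewrite /shiftz; apply: xy; lia.
rewrite -[leRHS]mulrA ler_wpM2l // mulrC ler_wpM2r ?exprn_ge0 //; exact: sum_geometric_le.
Qed.

(** The recurrent point visits the cylinder of [x] infinitely often. Two of its bounded products at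
    such times are close, so their quotient, the product between the two visits, is close to the
    identity. *)
Lemma cocycle_recurrence x r tau0 (e : R) : SFT H x -> 0 < e ->
  exists z tau, [/\ SFT H z, (tau0 <= tau)%N, agree r z x, agree r (shiftz tau%:Z z) x &
    nm (cocn A tau z - 1%:M) <= e].
Proof.
move=> Hx e0.
have [f fP] : {f : nat -> nat & forall m, (m <= f m)%N /\ agree r (shiftz (f m)%:Z x0) x}.
  apply: (@choice _ _ (fun m n => (m <= n)%N /\ agree r (shiftz n%:Z x0) x)) => m.
  by have [n mn nx] := rec r m Hx; exists n.
pose t := fix t i := if i is i'.+1 then f (t i' + tau0)%N else f 0%N.
have tx i : agree r (shiftz (t i)%:Z x0) x by case: i => [|i]; apply: (fP _).2.
have tS i j : (i < j)%N -> (t i + tau0 <= t j)%N.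
  elim: j => // j IHj; rewrite ltnS leq_eqVlt => /orP[/eqP ->|/IHj ij].
    exact: (fP (t j + tau0)%N).1.
  apply: leq_trans ij _; apply: leq_trans (fP (t j + tau0)%N).1; exact: leq_addr.
have ek0 : 0 < e / k by rewrite divr_gt0.
have [i [j [ij Mij]]] := @pigeonhole_mx _ _ (fun i => cocn A (t i) x0) k (e / k)
  (fun i => (bd (t i) Hx0).1) ek0.
have tij := tS i j ij; pose z := shiftz (t i)%:Z x0.
have Hz : SFT H z by apply: SFT_shiftz.
exists z, (t j - t i)%N; split => //; [by lia | exact: tx | |].
  by rewrite /z shiftzD -PoszD subnK; [apply: tx | lia].
have uM := cocn_unit (t i) GA Hx0.
have -> : cocn A (t j - t i) z - 1%:M =
    (cocn A (t j) x0 - cocn A (t i) x0) *m invmx (cocn A (t i) x0).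
  have -> : cocn A (t j) x0 = cocn A (t j - t i) z *m cocn A (t i) x0.
    by rewrite -cocnD subnK // (leq_trans (leq_addr _ _) tij).
  by rewrite mulmxBl mulmxV // mulmxK.
rewrite -[leRHS](divfK (lt0r_neq0 k0)).
by apply: nmM_le => //; apply: (bd _ Hx0).2.
Qed.

(** K(x) is handled through this decreasing family, without taking limit points; inclusions between
    limit sets become approximations up to [e]. *)
Definition tails x r g := exists n y, [/\ SFT H y, agree r y x & g = cocn A n y].

Lemma tails1 x r : SFT H x -> tails x r 1%:M.
Proof. by move=> Hx; exists 0%N, x; split. Qed.

Lemma tails_bd x r g : tails x r g -> [/\ g \in unitmx, nm g <= k & nm (invmx g) <= k].
Proof.
by move=> [n [y [Hy _ ->]]]; have [b1 b2] := bd n Hy; split => //; apply: cocn_unit GA Hy.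
Qed.

(* The detour of [y'] through a long loop on which the cocycle is almost trivial makes [y'] *)
(* follow [x'] for as long as desired before it follows [y].                                *)
Lemma tails_close (e : R) : 0 < e -> exists r, forall x x', SFT H x' -> agree r x x' ->
  forall r' g, tails x r g -> exists2 g', tails x' r' g' & nm (g - g') <= e.
Proof.
move=> e0; have e20 : 0 < e / 2 by rewrite divr_gt0.
have [r rP] := exp_small (K1 * (1 + k)) rho0 rho1 e20.
exists r => x x' Hx' xx' r' _ [n [y [Hy yx ->]]].
have yx' : agree r y x' by apply: agree_trans xx'.
have e'0 : 0 < e / (2 * k) by rewrite divr_gt0 // mulr_gt0.
(* [r] is already fixed; only the loop depends on r'. It starts within radius r' of x' and lasts at
   least r' steps, so the detour agrees with x' on [-r', r']. *)
have [z [tau [Hz r'tau zx tzx zA]]] := cocycle_recurrence (maxn r r') r' Hx' e'0.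
have zx1 : agree r (shiftz tau%:Z z) x' by apply: agree_le tzx; apply: leq_maxl.
have zy0 : shiftz tau%:Z z 0 = y 0 by rewrite zx1 // yx'.
pose w := glue (shiftz tau%:Z z) y.
have Hw : SFT H w by apply: SFT_glue => //; apply: SFT_shiftz.
have wz (i : int) : i <= r%:Z -> w i = shiftz tau%:Z z i by apply: glue_past zx1 yx'.
have wy (i : int) : - r%:Z <= i -> y i = w i by move=> ir; rewrite /w (glue_future zx1 yx').
pose y' := shiftz (- tau%:Z) w.
have Hy' : SFT H y' by apply: SFT_shiftz.
have y'w : shiftz tau%:Z y' = w by rewrite /y' shiftzD addrN shiftz0.
have y'z (i : int) : i <= tau%:Z + r%:Z -> y' i = z i.
  move=> itr; rewrite /y' /shiftz wz; last by move: itr; clear; lia.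
  by rewrite /shiftz subrK.
exists (cocn A (n + tau) y').
  exists (n + tau)%N, y'; split => // i ir'; rewrite y'z; last by move: ir' r'tau; clear; lia.
  by apply: zx; apply: leq_trans (leq_maxr _ _).
rewrite cocnD y'w.
(* Three errors: the common future of [y] and [w], the loop product against the identity, and the
   common past of [z] and y'. *)
have -> : cocn A n y - cocn A n w *m cocn A tau y' = (cocn A n y - cocn A n w) +
    cocn A n w *m ((1%:M - cocn A tau z) + (cocn A tau z - cocn A tau y')).
  by rewrite addrA subrK mulmxBr mulmx1 addrA subrK.
have l1 := cocn_close_future n Hy Hw wy.
have l2 : nm (cocn A tau z - cocn A tau y') <= K1 * rho ^+ r.
  by rewrite nmB; apply: cocn_close_past.
have l3 : nm (1%:M - cocn A tau z) <= e / (2 * k) by rewrite nmB.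
apply: le_trans (nmD _ _) _.
apply: (@le_trans _ _ (K1 * rho ^+ r + k * (e / (2 * k) + K1 * rho ^+ r))).
  apply: lerD => //; apply: nmM_le; first exact: (bd _ Hw).1.
  by apply: le_trans (nmD _ _) _; apply: lerD.
have -> : K1 * rho ^+ r + k * (e / (2 * k) + K1 * rho ^+ r) =
    K1 * (1 + k) * rho ^+ r + e / 2 by field; rewrite gt_eqF.
by have := rP; lra.
Qed.

Lemma A_bd x : SFT H x -> [/\ A x \in unitmx, nm (A x) <= k & nm (invmx (A x)) <= k].
Proof.
by move=> Hx; have := bd 1 Hx; rewrite cocn1 => -[b1 b2]; split => //; apply: GA.
Qed.

(** For [y] near sigma x, the preimage of [y] is near [x], and its product of length n + 1 is A_n(y)
    times a matrix close to A(x). *)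
Lemma tails_shift x r (e : R) : SFT H x -> 0 < e -> exists r', forall g,
  tails (shiftz 1 x) r' g -> exists2 g', tails x r g' & nm (g *m A x - g') <= e.
Proof.
move=> Hx e0; have [r1 r1P] := exp_small (k * C) rho0 rho1 e0.
exists (maxn r r1).+1 => _ [n [y [Hy yx ->]]].
have Hy' : SFT H (shiftz (-1) y) by apply: SFT_shiftz.
have y'x : agree (maxn r r1) (shiftz (-1) y) x.
  rewrite -[x in agree _ _ x]shiftz0 -(addNr 1) -shiftzD.
  by apply: agree_shiftz yx; rewrite addn1.
exists (cocn A (n + 1) (shiftz (-1) y)).
  by exists (n + 1)%N, (shiftz (-1) y); split => //; apply: agree_le y'x; apply: leq_maxl.
rewrite cocnD shiftzD subrr shiftz0 cocn1 -mulmxBr; apply: le_trans r1P.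
rewrite -mulrA; apply: nmM_le; first exact: (bd _ Hy).1.
by rewrite nmB; apply: (varA (r := r1)) => //; apply: agree_le y'x; apply: leq_maxr.
Qed.

Lemma tails_unshift x r (e : R) : SFT H x -> 0 < e -> exists r', forall g,
  tails x r' g -> exists2 g', tails (shiftz 1 x) r g' & nm (g *m invmx (A x) - g') <= e.
Proof.
move=> Hx e0; have e20 : 0 < e / 2 by rewrite divr_gt0.
have [r1 r1P] := exp_small (k * C * k) rho0 rho1 e20.
have [uA _ AVk] := A_bd Hx.
set r' := (maxn r r1).+1; exists r'.
have step n y : SFT H y -> agree r' y x -> exists2 g', tails (shiftz 1 x) r g' &
    nm (cocn A (n + 1) y *m invmx (A x) - g') <= e / 2.
  move=> Hy yx; have Hy' : SFT H (shiftz 1 y) by apply: SFT_shiftz.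
  exists (cocn A n (shiftz 1 y)).
    exists n, (shiftz 1 y); split => //; apply: agree_shiftz yx.
    by rewrite addn1 ltnS leq_maxl.
  have -> : cocn A (n + 1) y *m invmx (A x) - cocn A n (shiftz 1 y) =
      cocn A n (shiftz 1 y) *m (A y - A x) *m invmx (A x).
    by rewrite cocnD cocn1 mulmxBr mulmxBl mulmxK.
  apply: le_trans r1P; rewrite [leRHS]mulrAC; apply: nmM_le => //.
  rewrite -mulrA; apply: nmM_le; first exact: (bd _ Hy').1.
  by apply: (varA (r := r1)) => //; apply: agree_le yx; rewrite leqW // leq_maxr.
move=> _ [[|n] [y [Hy yx ->]]]; last first.
  have [g' g'x le_e] := step n y Hy yx; exists g' => //.
  by rewrite -addn1; apply: le_trans le_e _; rewrite ler_pdivrMr // ler_pMr // ler1n.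
(* The empty product has no first factor to cancel against A(x); it is first replaced by a nearly
   trivial loop of positive length. *)
have e'0 : 0 < e / (2 * k) by rewrite divr_gt0 // mulr_gt0.
have [z [[|tau] [Hz tau0 zx _ zA]]] := cocycle_recurrence r' 1 Hx e'0; first by [].
have [g' g'x le_e] := step tau z Hz zx; exists g' => //=.
have -> : 1%:M *m invmx (A x) - g' = (1%:M - cocn A tau.+1 z) *m invmx (A x) +
    (cocn A (tau + 1) z *m invmx (A x) - g').
  by rewrite mulmxBl addn1 addrA subrK.
apply: le_trans (nmD _ _) _.
apply: (@le_trans _ _ (e / (2 * k) * k + e / 2)).
  by apply: lerD => //; apply: nmM_le => //; rewrite nmB.
suff -> : e / (2 * k) * k + e / 2 = e by [].
by field; rewrite gt_eqF.
Qed.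

End BoundedCocycle.

(** * Admissible forms for a bounded family of matrices *)

Section InvariantForm.
Variables (R : realType) (d : nat) (k : R).
Hypothesis k1 : 1 <= k.
Implicit Types (S : nat -> 'M[R]_d -> Prop) (P g : 'M[R]_d) (t u : R).

Let k0 : 0 < k. Proof. exact: lt_le_trans k1. Qed.

Definition bounded_family S := [/\ forall r, S r 1%:M,
  forall r r' g, (r <= r')%N -> S r' g -> S r g &
  forall r g, S r g -> [/\ g \in unitmx, nm g <= k & nm (invmx g) <= k]].

(* In the limit r -> oo, all the forms [g P g^T] with [g] in [S r] have squared Frobenius *)
(* norm at most [t] and are bounded below by [u] times the Euclidean form.               *)
Definition adm S P t u := P^T = P /\ forall e, 0 < e -> exists r, forall g, S r g ->
  fn2 (g *m P *m g^T) <= t + e /\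
  forall v, (u - e) * sqn v <= qform (g *m P *m g^T) v.

Lemma adm_le S P t t' u : t <= t' -> adm S P t u -> adm S P t' u.
Proof.
move=> tt' [sP aP]; split => // e e0; have [r rP] := aP e e0; exists r => g Sg.
by have [f q] := rP g Sg; split => //; apply: le_trans f _; rewrite lerD2r.
Qed.

Lemma adm_bounds S P t u : bounded_family S -> adm S P t u ->
  fn2 P <= t /\ forall v, u * sqn v <= qform P v.
Proof.
move=> [S1 _ _] [_ aP]; split => [|v].
  apply: (@eps_le _ _ _ 1) => // e e0; have [r rP] := aP e e0.
  by have [+ _] := rP _ (S1 r); rewrite trmx1 mulmx1 !mul1mx mul1r.
apply: (@eps_le _ _ _ (sqn v)); first exact: sqn_ge0.
move=> e e0; have [r rP] := aP e e0; have [_ /(_ v)] := rP _ (S1 r).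
by rewrite trmx1 mulmx1 mul1mx mulrBl lerBlDr [e * _]mulrC.
Qed.

(** A quarter of a lower bound for fn2 (g P g^T) / fn2 P, from P = g^{-1} (g P g^T) g^{-T}. The
    [+ 1] keeps it positive when d = 0. *)
Definition convexity : R := (4 * (k ^+ 4 * ((d * d)%:R ^+ 2 + 1)))^-1.

Lemma convexity_gt0 : 0 < convexity.
Proof.
by rewrite invr_gt0 !mulr_gt0 ?exprn_gt0 // ltr_wpDl // exprn_ge0.
Qed.

Lemma fn2_conj_ge g P : g \in unitmx -> nm (invmx g) <= k ->
  4 * convexity * fn2 P <= fn2 (g *m P *m g^T).
Proof.
move=> ug gk; set X := g *m P *m g^T.
have PE : P = invmx g *m X *m (invmx g)^T.
  by rewrite /X !mulmxA mulVmx // mul1mx -mulmxA -trmx_mul mulVmx // trmx1 mulmx1.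
have leP : nm P <= k ^+ 2 * nm X.
  rewrite {1}PE expr2 mulrAC; apply: nmM_le; last by rewrite nm_tr.
  exact: nmM_le.
have dd0 : 0 < (d * d)%:R ^+ 2 + 1 :> R by rewrite ltr_wpDl // exprn_ge0.
have -> : 4 * convexity * fn2 P = fn2 P / (k ^+ 4 * ((d * d)%:R ^+ 2 + 1)).
  by rewrite /convexity; field; rewrite !gt_eqF.
rewrite ler_pdivrMr ?mulr_gt0 ?exprn_gt0 //.
apply: le_trans (fn2_nm _) _.
apply: (@le_trans _ _ ((k ^+ 2 * nm X) ^+ 2)).
  by rewrite ler_sqr ?nnegrE ?mulr_ge0 ?exprn_ge0 ?nm_ge0 // ltW.
rewrite exprMn -exprM mulrC [leRHS]mulrCA [leRHS]mulrC ler_wpM2r ?exprn_ge0 ?(ltW k0) //.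
apply: le_trans (nm_fn2 _) _; rewrite mulrC ler_wpM2l ?fn2_ge0 //.
by rewrite lerDl.
Qed.

(** The parallelogram identity for g P g^T and g P' g^T gains a quarter of fn2 (g (P - P') g^T),
    bounded below uniformly in g by [fn2_conj_ge]. The lower bound on forms is linear in P and
    survives averaging. *)
Lemma adm_mid S P P' t t' u : bounded_family S -> adm S P t u -> adm S P' t' u ->
  adm S (2^-1 *: (P + P')) (2^-1 * (t + t') - convexity * fn2 (P - P')) u.
Proof.
move=> [_ Sdec Sbd] [sP aP] [sP' aP']; split.
  by rewrite linearZ /= linearD /= sP sP'.
move=> e e0; have [r rP] := aP e e0; have [r' rP'] := aP' e e0.
exists (maxn r r') => g Sg; have [ug gk gVk] := Sbd _ _ Sg.
have [f q] := rP g (Sdec _ _ _ (leq_maxl _ _) Sg).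
have [f' q'] := rP' g (Sdec _ _ _ (leq_maxr _ _) Sg).
have -> : g *m (2^-1 *: (P + P')) *m g^T = 2^-1 *: (g *m P *m g^T + g *m P' *m g^T).
  by rewrite -scalemxAr -scalemxAl mulmxDr mulmxDl.
split => [|v].
  rewrite fn2_parallelogram.
  have -> : g *m P *m g^T - g *m P' *m g^T = g *m (P - P') *m g^T.
    by rewrite mulmxBr mulmxBl.
  by have := fn2_conj_ge (P - P') ug gVk; lra.
by rewrite qformZ qformD; have := q v; have := q' v; lra.
Qed.

(** Some admissible form must exist before minimizing: g^{-1} bounded by k gives k^2 |g^T v|^2 >=
    |v|^2. *)
Lemma adm_scalar S : bounded_family S -> adm S (k ^+ 2)%:M (k ^+ 8) 1.
Proof.
move=> [_ _ Sbd]; split; first by rewrite tr_scalar_mx.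
move=> e e0; exists 0%N => g Sg; have [ug gk gVk] := Sbd _ _ Sg.
rewrite mul_mx_scalar -scalemxAl; split => [|v].
  apply: (@le_trans _ _ (k ^+ 8)); last by rewrite lerDl ltW.
  apply: le_trans (fn2_nm _) _; rewrite -[8%N]/(4 * 2)%N exprM.
  rewrite ler_sqr ?nnegrE ?nm_ge0 ?exprn_ge0 ?(ltW k0) //.
  rewrite nmZ ger0_norm ?exprn_ge0 ?(ltW k0) // -[4%N]/(2 + 2)%N exprD.
  rewrite ler_wpM2l ?exprn_ge0 ?(ltW k0) // [leRHS]expr2; apply: nmM_le => //.
  by rewrite nm_tr.
rewrite qformZ -{1}[g]mulmx1 qform_conj qform1.
apply: (@le_trans _ _ (sqn v)).
  by rewrite mulrBl mul1r lerBlDr lerDl mulr_ge0 ?sqn_ge0 // ltW.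
have {1}-> : v = (invmx g)^T *m (g^T *m v).
  by rewrite mulmxA -trmx_mul mulmxV // trmx1 mul1mx.
apply: le_trans (sqn_mul _ _) _; rewrite nm_tr ler_wpM2r ?sqn_ge0 //.
by rewrite ler_sqr ?nnegrE ?nm_ge0 // ltW.
Qed.

Lemma form_perturb (X Y : 'M[R]_d) c eta : nm (X - Y) <= eta -> eta <= 1 -> nm Y <= c ->
  fn2 X <= fn2 Y + (2 * c + 1) * eta /\ forall v, qform Y v - (2 * c + 1) * eta * sqn v <= qform X v.
Proof.
move=> XY eta1 Yc; have eta0 : 0 <= eta := le_trans (nm_ge0 _) XY.
have c0 : 0 <= c := le_trans (nm_ge0 _) Yc.
have Xc : nm X <= c + 1.
  by apply: le_trans (nm_leB X Y) _; apply: lerD => //; apply: le_trans eta1.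
split => [|v].
  apply: le_trans (fn2_le_add X Y) _; rewrite lerD2l mulrC.
  by apply: ler_pM; rewrite ?addr_ge0 ?nm_ge0 //; lra.
have -> : qform X v = qform Y v + qform (X - Y) v by rewrite -qformD addrC subrK.
rewrite lerD2l; apply: lerNnormlW; apply: le_trans (qform_nm _ _) _.
rewrite ler_wpM2r ?sqn_ge0 //; apply: le_trans XY _.
by rewrite ler_peMl //; lra.
Qed.

Lemma adm_closed S P t u : bounded_family S ->
  (forall del, 0 < del -> exists P', nm (P - P') <= del /\ adm S P' (t + del) (u - del)) ->
  adm S P t u.
Proof.
move=> [_ _ Sbd] aP; split.
  apply/eqP; rewrite -subr_eq0; apply/eqP/fn2_eq0; apply: le_trans (fn2_nm _) _.
  rewrite -[leRHS](expr0n _ 2) ler_sqr ?nnegrE ?nm_ge0 //.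
  apply: (@eps_le _ _ _ 2) => // del del0; rewrite add0r.
  have [P' [PP' [sP' _]]] := aP del del0.
  apply: le_trans (nm_tri _ P' _) _.
  rewrite -{1}sP' -linearB /= nm_tr (nmB P'); lra.
(* [c] bounds the nearby forms g P' g^T, and [L * del] is the total error. *)
pose c := k ^+ 2 * (nm P + 1); pose L := k ^+ 2 * (2 * c + 1) + 2.
have c0 : 0 <= c by rewrite mulr_ge0 ?exprn_ge0 ?addr_ge0 ?nm_ge0 // ltW.
have kk0 : 0 <= k ^+ 2 by rewrite exprn_ge0 // ltW.
have kk1 : 1 <= k ^+ 2 by rewrite exprn_ege1.
have L0 : 0 < L by rewrite ltr_wpDl // mulr_ge0 // addr_ge0 // mulr_ge0.
move=> e e0; pose del := Num.min (k ^+ 2)^-1 (e / L).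
have del0 : 0 < del by rewrite lt_min invr_gt0 divr_gt0 // exprn_gt0.
have delk : k ^+ 2 * del <= 1.
  by rewrite -ler_pdivlMl ?exprn_gt0 // mulr1 ge_min lexx.
have delL : L * del <= e by rewrite -ler_pdivlMl // mulrC ge_min lexx orbT.
have [P' [PP' [_ aP']]] := aP del del0; have [r rP] := aP' del del0.
exists r => g Sg; have [ug gk gVk] := Sbd _ _ Sg; have [f q] := rP g Sg.
have XY : nm (g *m P *m g^T - g *m P' *m g^T) <= k ^+ 2 * del.
  rewrite -mulmxBl -mulmxBr expr2 mulrAC; apply: nmM_le; last by rewrite nm_tr.
  exact: nmM_le.
have Yc : nm (g *m P' *m g^T) <= c.
  rewrite /c expr2 mulrAC; apply: nmM_le; last by rewrite nm_tr.
  apply: nmM_le => //; apply: le_trans (nm_leB P' P) _; rewrite nmB lerD2l.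
  apply: le_trans PP' _; apply: le_trans delk; rewrite ler_peMl // ltW //.
have [f' q'] := form_perturb XY delk Yc.
have LE : (2 * c + 1) * (k ^+ 2 * del) + del + del = L * del by rewrite /L; ring.
split => [|v]; first by lra.
apply: le_trans (q' v); rewrite lerBrDr; apply: le_trans (q v).
by rewrite -mulrDl ler_wpM2r ?sqn_ge0 //; lra.
Qed.

Lemma adm_closed_tu S P t u : bounded_family S ->
  (forall del, 0 < del -> adm S P (t + del) (u - del)) -> adm S P t u.
Proof.
move=> bS aP; apply: adm_closed => // del del0; exists P.
by rewrite subrr nm0 ltW //; split => //; apply: aP.
Qed.

Lemma adm_scale S P t u s : 0 < s -> adm S P t u -> adm S (s *: P) (s ^+ 2 * t) (s * u).
Proof.
move=> s0 [sP aP]; split; first by rewrite linearZ /= sP.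
move=> e e0; pose e' := Num.min (e / s ^+ 2) (e / s).
have e'0 : 0 < e' by rewrite lt_min !divr_gt0 // exprn_gt0.
have e's2 : s ^+ 2 * e' <= e by rewrite -ler_pdivlMl ?exprn_gt0 // mulrC ge_min lexx.
have e's : s * e' <= e by rewrite -ler_pdivlMl // mulrC ge_min lexx orbT.
have [r rP] := aP e' e'0; exists r => g Sg; have [f q] := rP g Sg.
rewrite -scalemxAr -scalemxAl; split => [|v].
  rewrite fn2Z; apply: (@le_trans _ _ (s ^+ 2 * (t + e'))).
    by rewrite ler_wpM2l // exprn_ge0 // ltW.
  by rewrite mulrDr lerD2l.
rewrite qformZ; apply: (@le_trans _ _ (s * ((u - e') * sqn v))).
  by rewrite mulrA ler_wpM2r ?sqn_ge0 // mulrBr lerD2l lerN2.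
by rewrite ler_wpM2l // ltW.
Qed.

(** The factor (2 k + 1) c comes from replacing g by a nearby h in g P g^T, the last factor from
    [form_perturb]. *)
Definition lip (c : R) : R := (2 * k + 1) * c * (2 * (k ^+ 2 * c) + 1).

Lemma lip_ge0 c : 0 <= c -> 0 <= lip c.
Proof. by move=> c0; rewrite !mulr_ge0 ?addr_ge0 ?mulr_ge0 ?exprn_ge0 // ltW. Qed.

(* One estimate gives both the equivariance ([eta -> 0]) and the continuity ([B = 1]). *)
Lemma adm_transfer S S' B P t u c eta : bounded_family S -> nm P <= c -> 0 <= eta ->
  eta <= 1 -> (2 * k + 1) * c * eta <= 1 ->
  (forall r, exists r', forall g', S' r' g' ->
     exists2 g, S r g & nm (g' *m B - g) <= eta) ->
  adm S P t u -> adm S' (B *m P *m B^T) (t + lip c * eta) (u - lip c * eta).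
Proof.
move=> [_ _ Sbd] Pc eta0 eta1 etac tr [sP aP]; split.
  by rewrite !trmx_mul trmxK sP mulmxA.
move=> e e0; have [r rP] := aP e e0; have [r' r'P] := tr r.
exists r' => g' /r'P[g Sg gg']; have [ug gk gVk] := Sbd _ _ Sg; have [f q] := rP g Sg.
set h := g' *m B in gg'.
have -> : g' *m (B *m P *m B^T) *m g'^T = h *m P *m h^T by rewrite /h trmx_mul !mulmxA.
have c0 : 0 <= c := le_trans (nm_ge0 _) Pc.
have hk : nm h <= k + 1.
  by apply: le_trans (nm_leB h g) _; apply: lerD => //; apply: le_trans eta1.
have XY : nm (h *m P *m h^T - g *m P *m g^T) <= (2 * k + 1) * c * eta.
  have -> : h *m P *m h^T - g *m P *m g^T = (h - g) *m P *m h^T + g *m P *m (h - g)^T.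
    by rewrite linearB /= mulmxBl mulmxBl mulmxBr addrA subrK.
  apply: le_trans (nmD _ _) _.
  apply: (@le_trans _ _ (eta * c * (k + 1) + k * c * eta)); last by lra.
  apply: lerD; apply: nmM_le; rewrite ?nm_tr //; exact: nmM_le.
have Yc : nm (g *m P *m g^T) <= k ^+ 2 * c.
  by rewrite expr2 mulrAC; apply: nmM_le; [apply: nmM_le | rewrite nm_tr].
have [f' q'] := form_perturb XY etac Yc.
have lE : (2 * (k ^+ 2 * c) + 1) * ((2 * k + 1) * c * eta) = lip c * eta.
  by rewrite /lip; ring.
rewrite lE in f' q'; split => [|v]; first by lra.
apply: le_trans (q' v); rewrite lerBrDr; apply: le_trans (q v).
by rewrite -mulrDl ler_wpM2r ?sqn_ge0 //; lra.
Qed.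

Lemma adm_equiv S S' B P t u : bounded_family S -> bounded_family S' ->
  (forall r eta, 0 < eta -> exists r', forall g', S' r' g' ->
     exists2 g, S r g & nm (g' *m B - g) <= eta) ->
  adm S P t u -> adm S' (B *m P *m B^T) t u.
Proof.
move=> bS bS' tr aP; apply: adm_closed_tu => // del del0.
set c := nm P; have c0 : 0 <= c := nm_ge0 _.
have l1 : 0 < lip c + 1 by rewrite ltr_wpDl // lip_ge0.
have l2 : 0 < (2 * k + 1) * c + 1 by rewrite ltr_wpDl // mulr_ge0 // addr_ge0 // mulr_ge0 // ltW.
pose eta := Num.min (Num.min 1 (del / (lip c + 1))) ((2 * k + 1) * c + 1)^-1.
have eta0 : 0 < eta by rewrite !lt_min ltr01 divr_gt0 // invr_gt0.
have e1 : eta <= 1 by rewrite !ge_min lexx.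
have e2 : (lip c + 1) * eta <= del by rewrite -ler_pdivlMl // mulrC !ge_min lexx !orbT.
have e3 : ((2 * k + 1) * c + 1) * eta <= 1 by rewrite -ler_pdivlMl // mulr1 !ge_min lexx !orbT.
have e3' : (2 * k + 1) * c * eta <= 1.
  by apply: le_trans e3; rewrite ler_wpM2r ?(ltW eta0) // lerDl.
have aP' := adm_transfer bS (lexx c) (ltW eta0) e1 e3' (fun r => tr r eta eta0) aP.
have le_del : lip c * eta <= del.
  by apply: le_trans e2; rewrite ler_wpM2r ?(ltW eta0) // lerDl.
case: aP' => sP' aP'; split => // e e0; have [r rP] := aP' e e0; exists r => g Sg.
have [f q] := rP g Sg; split => [|v]; first by lra.
by apply: le_trans (q v); rewrite ler_wpM2r ?sqn_ge0 //; lra.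
Qed.

End InvariantForm.

(** * The minimal form and its dependence on the family *)

(** The limit is the supremum of the eventual lower bounds. It is given for every sequence, before
    [e] and [J], so that it can be chosen entry by entry; the conclusion includes the rate. *)
Lemma real_cauchy_lim (R : realType) (u : nat -> R) :
  exists l, forall e J, (forall i j, (J <= i)%N -> (J <= j)%N -> u i - u j <= e) ->
    `|l - u J| <= e.
Proof.
pose E := [set x | exists J, forall j, (J <= j)%N -> x <= u j].
exists (sup E) => e J uJ.
have inE : E (u J - e).
  by exists J => j Jj; rewrite lerBlDr -lerBlDl; apply: uJ.
have ubE : ubound E (u J + e).
  move=> x [J' xJ']; apply: le_trans (xJ' (maxn J J') (leq_maxr _ _)) _.
  by rewrite -lerBlDl; apply: uJ => //; apply: leq_maxl.
rewrite ler_distl; apply/andP; split; first by apply: ub_le_sup => //; exists (u J + e).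
by apply: ge_sup => //; exists (u J - e).
Qed.

Section Minimizer.
Variables (R : realType) (d : nat) (k : R).
Hypothesis k1 : 1 <= k.
Implicit Types (S : nat -> 'M[R]_d -> Prop) (P g : 'M[R]_d) (t u : R).

Let k0 : 0 < k. Proof. exact: lt_le_trans k1. Qed.
Let c := convexity d k.
Let c0 : 0 < c. Proof. exact: convexity_gt0. Qed.

Definition minval S := inf [set t | exists P, adm S P t 1].

Lemma minval_le S P t : bounded_family k S -> adm S P t 1 -> minval S <= t.
Proof.
move=> bS aP; apply: ge_inf; last by exists P.
exists 0 => t' [P' aP']; apply: le_trans (fn2_ge0 P') _.
exact: (adm_bounds bS aP').1.
Qed.

Lemma minval_approx S e : bounded_family k S -> 0 < e -> exists P, adm S P (minval S + e) 1.
Proof.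
move=> bS e0; have [|t [P aP] tm] := @inf_adherent _ [set t | exists P, adm S P t 1] e e0.
  split; first by exists (k ^+ 8); exists (k ^+ 2)%:M; apply: adm_scalar.
  exists 0 => t' [P' aP']; apply: le_trans (fn2_ge0 P') _.
  exact: (adm_bounds bS aP').1.
by exists P; apply: adm_le aP; apply: ltW.
Qed.

(** The midpoint is admissible and cannot go below the minimum, so the gain in [adm_mid] is at most
    e. *)
Lemma near_min_close S P P' e : bounded_family k S ->
  adm S P (minval S + e) 1 -> adm S P' (minval S + e) 1 -> fn2 (P - P') <= e / c.
Proof.
move=> bS aP aP'; have := minval_le bS (adm_mid k1 bS aP aP').
by rewrite ler_pdivlMr // -/c [fn2 _ * c]mulrC; lra.
Qed.

Lemma minimizer_exists S : bounded_family k S -> exists P, adm S P (minval S) 1.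
Proof.
move=> bS.
have [F FP] : {F : nat -> 'M[R]_d & forall n, adm S (F n) (minval S + n.+1%:R^-1) 1}.
  apply: (@choice _ _ (fun n P => adm S P (minval S + n.+1%:R^-1) 1)) => n.
  by apply: minval_approx => //; rewrite invr_gt0.
have [l lP] : {l : 'I_d * 'I_d -> R & forall p e J,
    (forall i j, (J <= i)%N -> (J <= j)%N -> F i p.1 p.2 - F j p.1 p.2 <= e) ->
    `|l p - F J p.1 p.2| <= e}.
  apply: (@choice _ _ (fun p x => forall e J,
    (forall i j, (J <= i)%N -> (J <= j)%N -> F i p.1 p.2 - F j p.1 p.2 <= e) ->
    `|x - F J p.1 p.2| <= e)) => p.
  exact: (real_cauchy_lim (fun n => F n p.1 p.2)).
pose P : 'M[R]_d := \matrix_(i, j) l (i, j).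
exists P; apply: (adm_closed k1 bS) => del del0.
have dd0 : 0 < (d * d)%:R + 1 :> R by rewrite ltr_wpDl.
pose e := del / ((d * d)%:R + 1); have e0 : 0 < e by rewrite divr_gt0.
(* Beyond J the excess over the minimum is at most [del] and at most c e^2; the latter keeps entries
   within e of each other. *)
pose J := maxn (Num.bound del^-1) (Num.bound (c * e ^+ 2)^-1).
have JV n (a : R) : 0 < a -> (Num.bound a^-1 <= n)%N -> n.+1%:R^-1 <= a.
  move=> a0 an; rewrite invf_ple ?posrE //; apply: ltW.
  apply: lt_le_trans (archi_boundP _) _; first by rewrite invr_ge0 ltW.
  by rewrite ler_nat leqW.
have close p : `|l p - F J p.1 p.2| <= e.
  apply: lP => i j Ji Jj; apply: le_trans (ler_norm _) _.
  rewrite -(@ler_pXn2r _ 2%N) ?nnegrE ?(ltW e0) // -normrX ger0_norm ?sqr_ge0 //.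
  have le_J n : (J <= n)%N -> adm S (F n) (minval S + c * e ^+ 2) 1.
    move=> Jn; apply: adm_le (FP n); rewrite lerD2l.
    apply: JV; first by rewrite mulr_gt0 // exprn_gt0.
    by apply: leq_trans Jn; apply: leq_maxr.
  have := near_min_close bS (le_J i Ji) (le_J j Jj).
  rewrite mulrAC divff ?gt_eqF // mul1r; apply: le_trans.
  by have := fn2_entry (F i - F j) p.1 p.2; rewrite !mxE.
exists (F J); split; last first.
  case: (FP J) => sF aF; split => // e' e'0; have [r rP] := aF e' e'0.
  exists r => g Sg; have [f q] := rP g Sg; split => [|v].
    apply: le_trans f _; rewrite lerD2r lerD2l; apply: JV => //.
    exact: leq_maxl.
  by apply: le_trans (q v); rewrite ler_wpM2r ?sqn_ge0 //; lra.
apply: (@le_trans _ _ ((d * d)%:R * e)); last first.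
  by rewrite /e mulrCA ger_pMr // ler_pdivrMr // mul1r lerDl.
by apply: nm_le_entries => a b; rewrite !mxE; apply: (close (a, b)).
Qed.

Definition minimizer S := xget 0 [set P | adm S P (minval S) 1].

Lemma minimizerP S : bounded_family k S -> adm S (minimizer S) (minval S) 1.
Proof. by move=> bS; apply: (xgetPex 0 (minimizer_exists bS)). Qed.

Lemma minimizer_unique S P : bounded_family k S -> adm S P (minval S) 1 ->
  P = minimizer S.
Proof.
move=> bS aP; apply/eqP; rewrite -subr_eq0; apply/eqP/fn2_eq0.
rewrite -[leRHS](mul0r c^-1); apply: (near_min_close bS); rewrite addr0 //.
exact: minimizerP.
Qed.

(** Transport in both directions shows that the minimal values agree; the image of one minimizer is
    then the other by uniqueness. *)
Lemma minimizer_equivariant S S' B : B \in unitmx ->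
  bounded_family k S -> bounded_family k S' ->
  (forall r eta, 0 < eta -> exists r', forall g', S' r' g' ->
     exists2 g, S r g & nm (g' *m B - g) <= eta) ->
  (forall r eta, 0 < eta -> exists r', forall g', S r' g' ->
     exists2 g, S' r g & nm (g' *m invmx B - g) <= eta) ->
  minimizer S' = B *m minimizer S *m B^T.
Proof.
move=> uB bS bS' SS' S'S; apply/esym/minimizer_unique => //.
have aS := adm_equiv k1 bS bS' SS' (minimizerP bS).
have aS' := adm_equiv k1 bS' bS S'S (minimizerP bS').
suff -> : minval S' = minval S by [].
by apply/eqP; rewrite eq_le (minval_le bS' aS) (minval_le bS aS').
Qed.

Let D : R := (d * d)%:R * k ^+ 4.

Lemma minval_bound S : bounded_family k S -> minval S <= k ^+ 8.
Proof. by move=> bS; apply: minval_le bS (adm_scalar k1 bS). Qed.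

Lemma minval_ge0 S : bounded_family k S -> 0 <= minval S.
Proof.
move=> bS; apply: le_trans (fn2_ge0 (minimizer S)) _.
exact: (adm_bounds bS (minimizerP bS)).1.
Qed.

Lemma minimizer_bound S : bounded_family k S -> nm (minimizer S) <= D.
Proof.
move=> bS; rewrite -(@ler_pXn2r _ 2%N) ?nnegrE ?nm_ge0 //; last first.
  by rewrite mulr_ge0 // exprn_ge0 // ltW.
apply: le_trans (nm_fn2 _) _; rewrite exprMn ler_wpM2l ?exprn_ge0 // -exprM.
apply: le_trans (adm_bounds bS (minimizerP bS)).1 _; exact: minval_bound.
Qed.

Definition family_close S S' eta := forall r, exists r', forall g', S' r' g' ->
  exists2 g, S r g & nm (g' - g) <= eta.

(** For 0 <= a <= 1/2 and a minimum m <= k^8, (1 + 6 a) (m + a) <= m + E a. *)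
Let E : R := 6 * k ^+ 8 + 4.

(* Rescaling by [1 / (1 - a)] restores the lower bound 1 lost in the transfer. *)
Lemma adm_family_close S S' eta : bounded_family k S -> bounded_family k S' ->
  0 <= eta -> eta <= 1 -> (2 * k + 1) * D * eta <= 1 -> lip k D * eta <= 2^-1 ->
  family_close S S' eta ->
  let a := lip k D * eta in
  adm S' ((1 - a)^-1 *: minimizer S) (minval S + E * a) 1.
Proof.
move=> bS bS' eta0 eta1 e2 e3 SS' a.
have a0 : 0 <= a.
  by rewrite mulr_ge0 // lip_ge0 // mulr_ge0 // exprn_ge0 // ltW.
have a1 : a <= 2^-1 by [].
have s0 : 0 < (1 - a)^-1 by rewrite invr_gt0; lra.
have tr r : exists r', forall g', S' r' g' -> exists2 g, S r g & nm (g' *m 1%:M - g) <= eta.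
  by have [r' r'P] := SS' r; exists r' => g' /r'P; rewrite mulmx1.
have := adm_transfer bS (minimizer_bound bS) eta0 eta1 e2 tr (minimizerP bS).
rewrite trmx1 mulmx1 mul1mx -/a => /(adm_scale s0).
rewrite mulVf; last by rewrite gt_eqF //; lra.
apply: adm_le; set s := (1 - a)^-1.
have s2 : s <= 1 + 2 * a.
  rewrite -[s]mul1r ler_pdivrMr; last by lra.
  by nra.
have ss : s ^+ 2 <= 1 + 6 * a.
  apply: (@le_trans _ _ ((1 + 2 * a) ^+ 2)); last by nra.
  by rewrite ler_sqr ?nnegrE ?(ltW s0) //; lra.
have m0 := minval_ge0 bS; have m8 := minval_bound bS.
apply: (@le_trans _ _ ((1 + 6 * a) * (minval S + a))).
  by rewrite ler_wpM2r // addr_ge0.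
rewrite /E; nra.
Qed.

(** By [adm_family_close] in both directions, the rescaled minimizer of [S] nearly minimizes for
    [S'], and convexity puts it near the true minimizer. *)
Lemma minimizer_continuous e : 0 < e -> exists2 eta, 0 < eta & forall S S',
  bounded_family k S -> bounded_family k S' ->
  family_close S S' eta -> family_close S' S eta ->
  nm (minimizer S' - minimizer S) <= e.
Proof.
move=> e0.
have D0 : 0 <= D by rewrite mulr_ge0 // exprn_ge0 // ltW.
have L0 : 0 <= lip k D by rewrite lip_ge0.
have E0 : 0 < E by rewrite ltr_wpDl // mulr_ge0 // exprn_ge0 // ltW.
pose dd : R := (d * d)%:R ^+ 2 + 1.
have dd0 : 0 < dd by rewrite ltr_wpDl // exprn_ge0.
(* Three demands on a = lip * eta: rescaling is controlled, it moves the form by at most e / 2, and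
   the convexity estimate yields at most (e / 2)^2. *)
pose a1 := Num.min (Num.min 2^-1 (e / 2 / (2 * D + 1)))
  ((e / 2) ^+ 2 / (dd * (2 * E / c))).
have e20 : 0 < e / 2 by rewrite divr_gt0.
have D1 : 0 < 2 * D + 1 by rewrite ltr_wpDl // mulr_ge0.
have F0 : 0 < dd * (2 * E / c) by rewrite mulr_gt0 // divr_gt0 // mulr_gt0.
have a10 : 0 < a1.
  by rewrite !lt_min invr_gt0 ltr0n !divr_gt0 // exprn_gt0.
have l1 : 0 < lip k D + 1 by rewrite ltr_wpDl.
have l2 : 0 < (2 * k + 1) * D + 1.
  by rewrite ltr_wpDl // mulr_ge0 // addr_ge0 // mulr_ge0 // ltW.
pose eta := Num.min (Num.min 1 ((2 * k + 1) * D + 1)^-1) (a1 / (lip k D + 1)).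
have eta0 : 0 < eta by rewrite !lt_min ltr01 invr_gt0 l2 divr_gt0.
have eta1 : eta <= 1 by rewrite !ge_min lexx.
have eta2 : (2 * k + 1) * D * eta <= 1.
  have : ((2 * k + 1) * D + 1) * eta <= 1.
    by rewrite -ler_pdivlMl // mulr1 !ge_min lexx !orbT.
  by apply: le_trans; rewrite ler_wpM2r ?(ltW eta0) // lerDl.
have eta3 : lip k D * eta <= a1.
  have : (lip k D + 1) * eta <= a1 by rewrite -ler_pdivlMl // mulrC !ge_min lexx !orbT.
  by apply: le_trans; rewrite ler_wpM2r ?(ltW eta0) // lerDl.
pose a := lip k D * eta.
have a0 : 0 <= a by rewrite mulr_ge0 // ltW.
have aa1 : a <= a1 by [].
have ha : a <= 2^-1 by apply: le_trans aa1 _; rewrite !ge_min lexx.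
have ae : (2 * D + 1) * a <= e / 2.
  by rewrite -ler_pdivlMl // mulrC; apply: le_trans aa1 _; rewrite !ge_min lexx !orbT.
have aF : dd * (2 * E / c) * a <= (e / 2) ^+ 2.
  by rewrite -ler_pdivlMl // mulrC; apply: le_trans aa1 _; rewrite !ge_min lexx !orbT.
exists eta => // S S' bS bS' SS' S'S.
have aS' := adm_family_close bS bS' (ltW eta0) eta1 eta2 ha SS'.
have aS := adm_family_close bS' bS (ltW eta0) eta1 eta2 ha S'S.
rewrite -/a in aS aS'.
have mm := minval_le bS aS.
have EA : 0 <= E * a by rewrite mulr_ge0 // ltW.
have near1 : adm S' ((1 - a)^-1 *: minimizer S) (minval S' + 2 * E * a) 1.
  by apply: adm_le aS'; rewrite -mulrA; lra.
have near2 : adm S' (minimizer S') (minval S' + 2 * E * a) 1.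
  by apply: adm_le (minimizerP bS'); rewrite lerDl -mulrA mulr_ge0.
have close := near_min_close bS' near2 near1.
set s := (1 - a)^-1 in close; set Q := minimizer S in close *; set Q' := minimizer S' in close *.
apply: le_trans (nm_tri _ (s *: Q) _) _.
have le1 : nm (Q' - s *: Q) <= e / 2.
  rewrite -(@ler_pXn2r _ 2%N) ?nnegrE ?nm_ge0 ?(ltW e20) //.
  apply: le_trans (nm_fn2 _) _; apply: le_trans aF.
  apply: (@le_trans _ _ (dd * fn2 (Q' - s *: Q))).
    by rewrite ler_wpM2r ?fn2_ge0 // lerDl.
  by rewrite -mulrA ler_wpM2l ?(ltW dd0) // mulrAC.
have le2 : nm (s *: Q - Q) <= e / 2.
  have -> : s *: Q - Q = (s - 1) *: Q by rewrite scalerBl scale1r.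
  have s1 : 0 < 1 - a by lra.
  have sE : s - 1 = a / (1 - a) by rewrite /s; field; rewrite gt_eqF.
  have s2 : s - 1 <= 2 * a.
    by rewrite sE ler_pdivrMr //; nra.
  have s0 : 0 <= s - 1 by rewrite sE divr_ge0 // ltW.
  rewrite nmZ ger0_norm //.
  apply: (@le_trans _ _ (2 * a * D)).
    by apply: ler_pM => //; [apply: nm_ge0 | apply: minimizer_bound].
  by apply: le_trans ae; nra.
by lra.
Qed.

End Minimizer.

(** * Continuity of the Cholesky factor *)

Section Cholesky.
Variable R : realType.

(** Recursion on Schur complements uses only ring operations, inverses and square roots of pivots,
    so continuity can be checked entry by entry. *)
Fixpoint chol d : 'M[R]_d -> 'M[R]_d :=
  if d is d'.+1 then fun M : 'M[R]_(1 + d') =>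
    let a := ulsubmx M 0 0 in let b := dlsubmx M in
    block_mx (Num.sqrt a)%:M 0 ((Num.sqrt a)^-1 *: b)
             (chol (drsubmx M - a^-1 *: (b *m b^T)))
  else fun M => M.

Definition posdef d (M : 'M[R]_d) := M^T = M /\ forall v, v != 0 -> 0 < qform M v.

Lemma qform_block d (a s : R) (b w : 'cV[R]_d) (Q : 'M[R]_d) :
  qform (block_mx a%:M b^T b Q : 'M[R]_(1 + d)) (col_mx s%:M w) =
  a * s ^+ 2 + 2 * s * (b^T *m w) 0 0 + qform Q w.
Proof.
rewrite /qform tr_col_mx mul_row_block mul_row_col tr_scalar_mx.
have E2 : b^T *m w = ((b^T *m w) 0 0)%:M by apply: mx11_scalar.
have E1 : w^T *m b = ((b^T *m w) 0 0)%:M.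
  by rewrite -tr_scalar_mx -E2 trmx_mul trmxK.
have E3 : w^T *m Q *m w = ((w^T *m Q *m w) 0 0)%:M by apply: mx11_scalar.
rewrite !mulmxDl -[s%:M *m b^T *m w]mulmxA E1 E2 E3.
move: ((b^T *m w) 0 0) ((w^T *m Q *m w) 0 0) => be q.
by rewrite -!scalar_mxM !mxE eqxx !mulr1n; ring.
Qed.

(** Completing the square: with first coordinate - b^T w / a, the form takes at (s, w) the value of
    the Schur complement at w. *)
Lemma posdef_block d (M : 'M[R]_(1 + d)) : posdef M ->
  let a := ulsubmx M 0 0 in let b := dlsubmx M in
  [/\ 0 < a, M = block_mx a%:M b^T b (drsubmx M) &
      posdef (drsubmx M - a^-1 *: (b *m b^T))].
Proof.
move=> [sM pM] a b; set Q := drsubmx M.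
have ME : M = block_mx a%:M b^T b Q.
  rewrite -[LHS]submxK /Q -/b; congr (block_mx _ _ _ _).
    by rewrite [LHS]mx11_scalar.
  by rewrite /b trmx_dlsub sM.
have a0 : 0 < a.
  have := pM (col_mx 1%:M 0); rewrite ME qform_block mulmx0 /qform mulmx0 !mxE.
  rewrite expr1n mulr1 mulr0 !addr0; apply.
  apply/eqP => /(congr1 usubmx); rewrite col_mxKu linear0 => /matrixP/(_ 0 0).
  by rewrite !mxE eqxx => /eqP; rewrite oner_eq0.
split => //; split.
  rewrite linearB /= linearZ /= trmx_mul trmxK /Q trmx_drsub sM //.
move=> w w0; pose be := (b^T *m w) 0 0.
have := pM (col_mx (- be / a)%:M w); rewrite ME qform_block -/be.
have -> : qform (Q - a^-1 *: (b *m b^T)) w = qform Q w - be ^+ 2 / a.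
  rewrite -scaleNr qformD qformZ mulNr; congr (_ - _); rewrite mulrC; congr (_ * _).
  rewrite /qform mulmxA -mulmxA mxE big_ord1 -/be.
  by rewrite -[w^T *m b]trmxK trmx_mul trmxK mxE expr2.
have -> : a * (- be / a) ^+ 2 + 2 * (- be / a) * be + qform Q w = qform Q w - be ^+ 2 / a.
  by field; rewrite gt_eqF.
apply; apply/eqP => /(congr1 dsubmx); rewrite col_mxKd linear0 => /eqP.
by rewrite (negbTE w0).
Qed.

Lemma chol_mul d (M : 'M[R]_d) : posdef M -> chol M *m (chol M)^T = M.
Proof.
elim: d M => [|d IHd] M pM; first by apply/matrixP => -[].
have [a0 ME pS] := @posdef_block d M pM.
rewrite [chol M]/= -/(ulsubmx (M : 'M[R]_(1 + d))).
move: a0 ME pS; set a := ulsubmx _ 0 0; set b := dlsubmx _; set Q := drsubmx _.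
move=> a0 ME pS; rewrite [RHS]ME.
rewrite (@tr_block_mx _ 1 d 1 d) (@mulmx_block _ 1 d 1 d 1 d) (IHd _ pS).
rewrite trmx0 !mulmx0 !mul0mx !addr0 tr_scalar_mx mul_scalar_mx mul_mx_scalar.
have sa0 : Num.sqrt a != 0 by rewrite sqrtr_eq0 -ltNge.
apply: (f_equal4 (@block_mx R 1 d 1 d)).
- by rewrite scale_scalar_mx -expr2 sqr_sqrtr // ltW.
- by rewrite mul_scalar_mx linearZ /= scalerA mulfV // scale1r.
- by rewrite scalerA mulfV // scale1r.
rewrite linearZ /= -scalemxAl -scalemxAr scalerA -invfM -expr2 sqr_sqrtr ?(ltW a0) //.
by rewrite addrC subrK.
Qed.

Lemma posdef_factor_unit d (M P : 'M[R]_d) : posdef M -> P *m P^T = M -> P \in unitmx.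
Proof.
move=> [_ pM] PM; rewrite -row_free_unit; apply: inj_row_free => v vP.
apply/eqP; apply: contraT => v0; have := pM v^T.
rewrite -(inj_eq trmx_inj) trmxK trmx0 => /(_ v0).
by rewrite /qform trmxK -PM mulmxA vP !mul0mx mxE ltxx.
Qed.

Lemma chol_cvg (T : Type) (F : set_system T) (FF : Filter F) d
    (M : T -> 'M[R]_d) (M0 : 'M[R]_d) : posdef M0 ->
  (forall i j, M y i j @[y --> F] --> M0 i j) ->
  forall i j, chol (M y) i j @[y --> F] --> chol M0 i j.
Proof.
elim: d M M0 => [|d IHd] M M0 pM cM; first by case.
have [a0 _ pS] := @posdef_block d M0 pM.
move: a0 pS; set a := ulsubmx (M0 : 'M[R]_(1 + d)) 0 0; set b := dlsubmx (M0 : 'M[R]_(1 + d)).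
move=> a0 pS.
have ca : ulsubmx (M y : 'M[R]_(1 + d)) 0 0 @[y --> F] --> a.
  by rewrite /a !mxE; under eq_fun do rewrite !mxE; apply: cM.
have cb i : dlsubmx (M y : 'M[R]_(1 + d)) i 0 @[y --> F] --> b i 0.
  by rewrite /b !mxE; under eq_fun do rewrite !mxE; apply: cM.
have csq : Num.sqrt (ulsubmx (M y : 'M[R]_(1 + d)) 0 0) @[y --> F] --> Num.sqrt a.
  by apply: continuous_cvg ca; apply: sqrt_continuous.
have sa0 : Num.sqrt a != 0 by rewrite sqrtr_eq0 -ltNge.
have csV : (Num.sqrt (ulsubmx (M y : 'M[R]_(1 + d)) 0 0))^-1 @[y --> F] --> (Num.sqrt a)^-1.
  by apply: cvgV.
have caV : (ulsubmx (M y : 'M[R]_(1 + d)) 0 0)^-1 @[y --> F] --> a^-1.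
  by apply: cvgV => //; rewrite gt_eqF.
have cS := IHd (fun y => drsubmx (M y : 'M[R]_(1 + d)) - (ulsubmx (M y : 'M[R]_(1 + d)) 0 0)^-1 *:
  (dlsubmx (M y : 'M[R]_(1 + d)) *m (dlsubmx (M y : 'M[R]_(1 + d)))^T)) _ pS.
move=> i j.
case: (@split_ordP 1 d i) => i' ->; case: (@split_ordP 1 d j) => j' ->.
- have E (X : 'M[R]_(1 + d)) : chol X (lshift d i') (lshift d j') = Num.sqrt (ulsubmx X 0 0).
    apply: etrans (@block_mxEul R 1 d 1 d _ _ _ _ i' j') _.
    by rewrite (ord1 i') (ord1 j') mxE eqxx mulr1n.
  by rewrite E; under eq_fun do rewrite E.
- have E (X : 'M[R]_(1 + d)) : chol X (lshift d i') (rshift 1 j') = 0.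
    by apply: etrans (@block_mxEur R 1 d 1 d _ _ _ _ i' j') _; rewrite mxE.
  by rewrite E; under eq_fun do rewrite E; apply: cvg_cst.
- have E (X : 'M[R]_(1 + d)) : chol X (rshift 1 i') (lshift d j') =
      (Num.sqrt (ulsubmx X 0 0))^-1 * dlsubmx X i' 0.
    apply: etrans (@block_mxEdl R 1 d 1 d _ _ _ _ i' j') _.
    by rewrite (ord1 j') mxE.
  by rewrite E; under eq_fun do rewrite E; apply: cvgM.
have E (X : 'M[R]_(1 + d)) : chol X (rshift 1 i') (rshift 1 j') =
    chol (drsubmx X - (ulsubmx X 0 0)^-1 *: (dlsubmx X *m (dlsubmx X)^T)) i' j'.
  exact: (@block_mxEdr R 1 d 1 d _ _ _ _ i' j').
rewrite E; under eq_fun do rewrite E.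
apply: cS => u v.
have SE (X : 'M[R]_(1 + d)) : (drsubmx X - (ulsubmx X 0 0)^-1 *:
    (dlsubmx X *m (dlsubmx X)^T)) u v =
    X (rshift 1 u) (rshift 1 v) - (ulsubmx X 0 0)^-1 * (dlsubmx X u 0 * dlsubmx X v 0).
  by rewrite !mxE big_ord1 !mxE.
rewrite SE; under eq_fun do rewrite SE.
by apply: cvgB; [apply: cM | apply: cvgM => //; apply: cvgM].
Qed.

End Cholesky.

(** * The invariant form and the conjugacy *)

Section Conjugacy.
Variables (R : realType) (N : nat) (H : 'M[bool]_N) (d : nat).
Variables (A : spoint N -> 'M[R]_d) (k C rho : R) (x0 : spoint N).
Hypotheses (GA : GL_valued H A) (k1 : 1 <= k).
Hypothesis bd : forall n x, SFT H x ->
  nm (cocn A n x) <= k /\ nm (invmx (cocn A n x)) <= k.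
Hypotheses (C0 : 0 <= C) (rho0 : 0 <= rho) (rho1 : rho < 1).
Hypothesis varA : exp_varying H A C rho.
Hypotheses (Hx0 : SFT H x0) (rec : recurrent H x0).
Implicit Types (x y : spoint N).

Let S x := tails H A x.
Let Q x := minimizer (S x).

Lemma tails_bounded_family x : SFT H x -> bounded_family k (S x).
Proof.
move=> Hx; split; first by move=> r; apply: tails1.
  by move=> r r' g rr' [n [y [Hy yx ->]]]; exists n, y; split => //; apply: agree_le yx.
by move=> r g; apply: tails_bd.
Qed.

Lemma invariant_form_posdef x : SFT H x -> posdef (Q x).
Proof.
move=> /tails_bounded_family bS; have aS := minimizerP k1 bS; split; first exact: aS.1.
move=> v v0; apply: lt_le_trans (sqn_gt0 v0) _.
by have := (adm_bounds bS aS).2 v; rewrite mul1r.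
Qed.

Lemma invariant_form_equivariant x : SFT H x ->
  Q (Defs.shift x) = A x *m Q x *m (A x)^T.
Proof.
move=> Hx; have Hsx : SFT H (shiftz 1 x) by apply: SFT_shiftz.
apply: (minimizer_equivariant k1 (GA Hx)); try exact: tails_bounded_family.
  by move=> r eta; apply: (tails_shift bd rho0 rho1 varA).
by move=> r eta; apply: (tails_unshift GA k1 bd C0 rho0 rho1 varA Hx0 rec).
Qed.

Lemma invariant_form_continuous : locally_continuous H Q.
Proof.
move=> y Hy e e0; have [eta eta0 etaP] := minimizer_continuous d k1 e0.
have [r rP] := tails_close GA k1 bd C0 rho0 rho1 varA Hx0 rec eta0.
(* One radius serves every target radius r0; this is the strength of [tails_close]. *)
exists r => x Hx xy; apply: etaP; try exact: tails_bounded_family.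
  by move=> r0; exists r => g; apply: (rP x y Hy xy).
by move=> r0; exists r => g; apply: (rP y x Hx (agree_sym xy)).
Qed.

(** As a filter, the cylinders give access to limit theorems for the entries without a topology on
    the points. *)
Definition cylinder_filter x : set_system (spoint N) :=
  [set U | exists r, forall y, SFT H y -> agree r y x -> U y].

Lemma cylinder_filterP x : Filter (cylinder_filter x).
Proof.
split; first by exists 0%N.
  move=> U V [r rU] [r' rV]; exists (maxn r r') => y Hy yx; split.
    by apply: rU => //; apply: agree_le yx; apply: leq_maxl.
  by apply: rV => //; apply: agree_le yx; apply: leq_maxr.
by move=> U V UV [r rU]; exists r => y Hy yx; apply: UV; apply: rU.
Qed.

Lemma chol_invariant_form_continuous : locally_continuous H (fun x => chol (Q x)).
Proof.
move=> x Hx e e0; have FF := cylinder_filterP x.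
have cQ i j : Q y i j @[y --> cylinder_filter x] --> Q x i j.
  apply/cvgrPdist_le => e' e'0; have [r rP] := invariant_form_continuous Hx e'0.
  exists r => y Hy yx; rewrite distrC; apply: le_trans (rP y Hy yx).
  by apply: le_trans (nm_entry _ i j); rewrite !mxE.
have cP := chol_cvg FF (invariant_form_posdef Hx) cQ.
have dd0 : 0 < (d * d)%:R + 1 :> R by rewrite ltr_wpDl.
pose e' := e / ((d * d)%:R + 1); have e'0 : 0 < e' by rewrite divr_gt0.
have : \forall y \near cylinder_filter x,
    forall p : 'I_d * 'I_d, `|chol (Q x) p.1 p.2 - chol (Q y) p.1 p.2| <= e'.
  by apply: filter_forall => p; have /cvgrPdist_le := cP p.1 p.2; apply.
move=> [r rP]; exists r => y Hy yx.
apply: (@le_trans _ _ ((d * d)%:R * e')); last first.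
  by rewrite /e' mulrCA ger_pMr // ler_pdivrMr // mul1r lerDl.
by apply: nm_le_entries => a b; rewrite !mxE distrC; apply: (rP y Hy yx (a, b)).
Qed.

(** With Q = P P^T, equivariance says that X = P(sigma x)^{-1} A(x) P(x) satisfies X X^T = 1; for
    square matrices X^T X = 1 follows. *)
Lemma bounded_conj_isometric : conj_isometric H A.
Proof.
have unitP x : SFT H x -> chol (Q x) \in unitmx.
  by move=> /invariant_form_posdef pQ; apply: posdef_factor_unit pQ (chol_mul pQ).
exists (fun x => chol (Q x)); split => //.
  exact: locally_continuous_on_SFT chol_invariant_form_continuous.
move=> x Hx; have Hsx : SFT H (Defs.shift x) by apply: (@SFT_shiftz _ _ 1).
have QE := invariant_form_equivariant Hx.
rewrite -(chol_mul (invariant_form_posdef Hsx)) -(chol_mul (invariant_form_posdef Hx)) in QE.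
set P := chol (Q x) in QE *; set P' := chol (Q (Defs.shift x)) in QE *.
have uP' : P' \in unitmx by apply: unitP.
apply: mulmx1C.
have -> : invmx P' *m A x *m P *m (invmx P' *m A x *m P)^T =
    invmx P' *m (A x *m (P *m P^T) *m (A x)^T) *m (invmx P')^T.
  by rewrite !trmx_mul !mulmxA.
by rewrite -QE !mulmxA mulVmx // mul1mx -trmx_mul mulVmx // trmx1.
Qed.

End Conjugacy.

Theorem theoremD (R : realType) (N : nat) (H : 'M[bool]_N) (d : nat)
  (alpha : R) (A : spoint N -> 'M[R]_d) :
  0 < alpha ->
  transitive_SFT R H ->
  (0 < htop R (SFT H))%E ->
  holder H alpha A -> GL_valued H A ->
  (forall (An : nat -> spoint N -> 'M[R]_d),
     (forall n, continuous_on_SFT H (An n)) ->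
     (forall n, GL_valued H (An n)) ->
     (fun n => dC0 H A (An n)) @ \oo --> 0%E ->
     (exists2 kappa : R, 0 < kappa &
        (fun n => htop R (Bset H (An n) kappa)) @ \oo --> htop R (SFT H)) ->
     conj_isometric H A)
  /\
  ((exists2 kappa : R, 0 < kappa & htop R (Bset H A kappa) = htop R (SFT H)) ->
     conj_isometric H A).
Proof.
move=> alpha0 tr hpos hA GA.
have [C [rho [C0 rho0 rho1 varA]]] := holder_exp_varying alpha0 hA.
have cA := exp_varying_continuous rho0 rho1 varA.
have main (An : nat -> spoint N -> 'M[R]_d) kappa : (forall n, GL_valued H (An n)) ->
    (fun n => dC0 H A (An n)) @ \oo --> 0%E ->
    (fun n => htop R (Bset H (An n) kappa)) @ \oo --> htop R (SFT H) ->
    conj_isometric H A.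
  move=> GAn AnA hB; have [k k1 bd] := uniformly_bounded tr hpos cA GA GAn AnA hB.
  have [x0 Hx0 rec] := transitive_recurrent tr.
  exact: (bounded_conj_isometric GA k1 bd C0 rho0 rho1 varA Hx0 rec).
split; first by move=> An _ GAn AnA [kappa _ hB]; apply: main GAn AnA hB.
(* The particular case is the constant sequence. *)
move=> [kappa _ hB]; apply: (main (fun=> A) kappa); last first.
- by rewrite hB; apply: cvg_cst.
- rewrite (_ : dC0 H A A = 0%E); first exact: cvg_cst.
  (* The transitive point shows that the supremum is over a nonempty set, so it is 0 and not -oo. *)
  have [x0 Hx0 _] := tr; apply/eqP; rewrite eq_le; apply/andP; split.
    by apply: ge_ereal_sup => _ [x _ <-]; rewrite subrr opnorm0.
  apply: ereal_sup_ubound; exists x0; first exact: Hx0.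
  by rewrite subrr opnorm0.
- by move=> _; apply: GA.
Qed.
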